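(* Let $\mathcal{A}$ be a countable alphabet with at least two elements. Fix finite subsets $G,D$ of $\mathbb{Z}$ with $\min(G\cup D)=1$. Let $(\mathbb{P}_n)_{n\ge1}$ be a family of distributions of stationary $\mathcal{A}$-valued processes, where $\mathbb{P}_n$ has margin $\delta_n:=\delta_{D,G}^{(n)}$. Suppose $\Gamma(\mathbb{P}_n)\geq\Gamma>0$ for all $n\geq2$. In what follows $R(\hat f^n_{D,G})$ and $\beta_{D,G}$ are taken with respect to the measure $\mathbb{P}_n$. (i) If $\delta_n\sqrt{\frac{n}{\log n}}\to0$ as $n\to\infty$, then there exists $n_0\geq2$ such that for all $n\geq n_0$, $$R(\hat f^n_{D,G})\leq\frac12\sqrt{\frac{\log n}{n}}\wedge\beta_{D,G}.$$ (ii) If $\delta_n\sqrt{\frac{n}{\log n}}\to\infty$ as $n\to\infty$, then there exists $n_0'\geq1$ such that for all $n\geq n_0'$, $$R(\hat f^n_{D,G})\leq\exp\left(-\frac{\Gamma^2\,n\,\delta_n^2}{8(|G|+|D|)^2}\right)\wedge\beta_{D,G}.$$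
   Context: $\mathcal{A}$ is a countable set with the discrete topology and $\mathcal{A}^{\mathbb{Z}}$ carries the product topology. For finite $H\subset\mathbb{Z}$, $X_H=(X_i)_{i\in H}$; $\theta^iH=H+i=\{i+j:j\in H\}$. $\mathbb{Z}_-=\{-1,-2,\dots\}$. $u\wedge v=\min(u,v)$. Left conditional expectations and $\Gamma$. For a stationary process $(X_i)_{i\in\mathbb{Z}}$ with distribution $\mathbb{P}$, $p:\mathcal{A}\times\mathcal{A}^{\mathbb{Z}_-}\to[0,1]$ denotes a regular version of the left conditional expectations, i.e. $\mathbb{E}(\mathbf{1}_{\{X_0=a\}}\mid\sigma(X_{-\infty}^{-1}))(x)=p(a|x)$ for $\mathbb{P}$-a.e. $x$. For $n\ge 0$, $$\mathrm{Var}_n(p):=\sup\Big\{\tfrac12\sum_{a\in\mathcal{A}}|p(a|x)-p(a|y)|: x,y\in\mathcal{A}^{\mathbb{Z}_-},\ x_i=y_i \text{ for } i\ge -n\Big\},$$ where for $n=0$ the supremum is over all pairs $x,y$. Set $\Gamma(\mathbb{P}):=\prod_{j=0}^\infty(1-\mathrm{Var}_j(p))$. Estimator. $D$ is the data set and $G$ the guess set. For a sample $X_1^n=(X_1,\dots,X_n)$, $b\in\mathcal{A}^D$, $a\in\mathcal{A}^G$, let $$N^n_{D,G}(b,a):=\sum_{i=0}^{n-1}\mathbf{1}\{X_{\theta^iD}=b,\ X_{\theta^iG}=a\},$$ where the indicator is zero by convention if $\theta^iD$ or $\theta^iG$ is not included in $\{1,\dots,n\}$. The estimator is $\hat f^n_{D,G}(b):=\arg\max_{a\in\mathcal{A}^G}N^n_{D,G}(b,a)/n$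 (a maximizer), a function of $X_1^n$ and $b$. Excess risk with respect to $\mathbb{P}$. Let $(X_j)_{j\in\mathbb{Z}}$ and $(Y_j)_{j\in\mathbb{Z}}$ be two independent copies of the process with distribution $\mathbb{P}$, with joint law $\widetilde{\mathbb{P}}=\mathbb{P}\otimes\mathbb{P}$; $\hat f^n_{D,G}$ is computed from $X_1^n$. Then $$R(\hat f^n_{D,G}):=\sup_{b\in\mathcal{A}^D}\Big(\widetilde{\mathbb{P}}\big(\hat f^n_{D,G}(Y_D)\neq Y_G\mid Y_D=b\big)-\inf_{a\in\mathcal{A}^G}\widetilde{\mathbb{P}}\big(a\neq Y_G\mid Y_D=b\big)\Big)\,\widetilde{\mathbb{P}}(Y_D=b),$$ the expression being $0$ when $\widetilde{\mathbb{P}}(Y_D=b)=0$. Margin of $\mathbb{P}$. For $b\in\mathcal{A}^D$, $$\delta_{D,G}(b)=\inf\Big\{\mathbb{P}(X_G\neq c,X_D=b)-\inf_{a\in\mathcal{A}^G}\mathbb{P}(X_G\neq a,X_D=b)>0:\ c\in\mathcal{A}^G\Big\}$$ (the infimum of the strictly positive values), with $\delta_{D,G}(b)=0$ if the set is empty; the margin is $\delta_{D,G}:=\inf_{b\in\mathcal{A}^D}\delta_{D,G}(b)$. The margin of $\mathbb{P}_n$ is denoted $\delta_{D,G}^{(n)}$. Also $$\beta_{D,G}:=\sup_{b\in\mathcal{A}^D}\Big\{\sup_{a\in\mathcal{A}^G}\mathbb{P}(Y_G=a,Y_D=b)-\inf_{c\in\mathcal{A}^G}\mathbb{P}(Y_G=c,Y_D=b)\Big\}.$$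 *)

(* Defs.v *)
From HB Require Import structures.
From mathcomp Require Import all_boot all_order all_algebra finmap.
From mathcomp Require Import all_classical all_reals all_analysis.
Set Implicit Arguments.
Unset Strict Implicit.
Unset Printing Implicit Defensive.
Import Order.TTheory GRing.Theory Num.Theory.
Import numFieldNormedType.Exports.
Local Open Scope classical_set_scope.
Local Open Scope ring_scope.

(* The space I -> A with the product of the discrete sigma-algebras on A. *)
Definition coordinate_events (I : Type) (A : pointedType) : set (set (I -> A)) :=
  [set E | exists (i : I) (B : set A), E = [set x | B (x i)]].

Definition path_space (I : Type) (A : pointedType) :=
  g_sigma_algebraType (@coordinate_events I A).

Section Process.
Context (R : realType) (A : pointedType).

Local Notation law := (probability (path_space int A) R).

Definition shift (x : int -> A) : int -> A := fun i => x (i + 1).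

Definition stationary (P : law) : Prop :=
  forall E : set (path_space int A), measurable E -> P (shift @^-1` E) = P E.

(* The index set {-1, -2, ...} is encoded by nat, where k stands for
   Negz k = - (k + 1). *)
Definition past (x : path_space int A) : path_space nat A :=
  fun k => x (Negz k).

(* For every past, p ^~ x is a probability mass function on A. The events of
   the sigma-algebra generated by (X_i)_(i < 0) are the past @^-1` B. *)
Definition left_conditional_version (P : law)
    (p : A -> path_space nat A -> R) : Prop :=
  [/\ forall a x, 0 <= p a x,
      forall x, (\esum_(a in [set: A]) (p a x)%:E = 1)%E,
      forall a, measurable_fun [set: path_space nat A] (p a)
    & forall a (B : set (path_space nat A)), measurable B ->
        (\int[P]_(x in past @^-1` B) (p a (past x))%:E =
         P ([set x : path_space int A | x (0 : int) = a] `&` past @^-1` B))%E].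

Definition variation (p : A -> path_space nat A -> R) (n : nat) : R :=
  fine (ereal_sup [set r : \bar R | exists x y : path_space nat A,
    (forall k, (k < n)%N -> x k = y k) /\
    r = ((2^-1)%:E * \esum_(a in [set: A]) `|p a x - p a y|%:E)%E]).

Definition Gamma_coef (p : A -> path_space nat A -> R) : R :=
  lim ((fun n => \prod_(0 <= j < n) (1 - variation p j)) @ \oo).

Definition pattern (H : {fset int}) (x : int -> A) : {ffun H -> A} :=
  [ffun j : H => x (val j)].

(* X_{theta^i H}, read as a pattern on H. *)
Definition shifted_pattern (H : {fset int}) (i : int) (x : int -> A) :
    {ffun H -> A} :=
  [ffun j : H => x (i + val j)].

Definition sample (n : nat) (x : int -> A) : n.-tuple A :=
  [tuple x (i.+1)%:Z | i < n].

Definition pr (d : measure_display) (T : measurableType d)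
    (Q : probability T R) (E : set T) : R := fine (Q E).

(* Equal to 0 when Q F = 0. *)
Definition cpr (d : measure_display) (T : measurableType d)
    (Q : set T -> \bar R) (E F : set T) : R :=
  fine (Q (E `&` F)) / fine (Q F).

Section Guess.
Context (D G : {fset int}).

Definition in_sample (H : {fset int}) (n : nat) (i : int) : bool :=
  [forall j : H, 1 <= i + val j <= n%:Z].

Definition occurrences (n : nat) (x : int -> A)
    (b : {ffun D -> A}) (a : {ffun G -> A}) : nat :=
  \sum_(0 <= i < n)
    [&& in_sample D n i, in_sample G n i,
        shifted_pattern D i x == b & shifted_pattern G i x == a].

(* f n maps the sample X_1, ..., X_n and a pattern b to a maximizer of
   a |-> N^n(b, a) / n; the choice among several maximizers is arbitrary. *)
Definition is_estimator
    (f : forall n, n.-tuple A -> {ffun D -> A} -> {ffun G -> A}) : Prop :=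
  forall n (x : int -> A) (b : {ffun D -> A}) (a : {ffun G -> A}),
    (occurrences n x b a)%:R / n%:R <=
    (occurrences n x b (f n (sample n x) b))%:R / n%:R :> R.

(* The first component of the product space is the process X giving the
   sample, the second one is the independent copy Y. *)
Definition excess_risk (P : law) (n : nat)
    (f : n.-tuple A -> {ffun D -> A} -> {ffun G -> A}) : R :=
  let PP := (P \x P)%E in
  sup [set
    let YD := [set w : path_space int A * path_space int A |
                pattern D w.2 = b] in
    (cpr PP [set w | f (sample n w.1) (pattern D w.2) <> pattern G w.2] YD -
     inf [set cpr PP [set w | a <> pattern G w.2] YD
         | a in [set: {ffun G -> A}]]) * fine (PP YD)
    | b in [set: {ffun D -> A}]].

Definition miss (P : law) (b : {ffun D -> A}) (c : {ffun G -> A}) : R :=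
  pr P [set x : path_space int A | pattern G x <> c /\ pattern D x = b].

(* inf is 0 on the empty set. *)
Definition margin_at (P : law) (b : {ffun D -> A}) : R :=
  inf [set r : R | 0 < r /\ exists c : {ffun G -> A},
        r = miss P b c - inf [set miss P b a | a in [set: {ffun G -> A}]]].

Definition margin (P : law) : R :=
  inf [set margin_at P b | b in [set: {ffun D -> A}]].

Definition joint (P : law) (b : {ffun D -> A}) (a : {ffun G -> A}) : R :=
  pr P [set x : path_space int A | pattern G x = a /\ pattern D x = b].

Definition beta_coef (P : law) : R :=
  sup [set sup [set joint P b a | a in [set: {ffun G -> A}]] -
           inf [set joint P b c | c in [set: {ffun G -> A}]]
      | b in [set: {ffun D -> A}]].

End Guess.
End Process.

(* Main.v *)
Require Import Defs.
From HB Require Import structures.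
From mathcomp Require Import all_boot all_order all_algebra finmap.
From mathcomp Require Import all_classical all_reals all_analysis.
From mathcomp Require Import measurable_realfun ring lra zify.
Set Implicit Arguments.
Unset Strict Implicit.
Unset Printing Implicit Defensive.
Import Order.TTheory GRing.Theory Num.Theory.
Import numFieldNormedType.Exports.
Local Open Scope classical_set_scope.
Local Open Scope ring_scope.

(** Fix [n] and a pattern [b] on [D].  Let [N(a)] be the number of occurrences
    of [(b, a)] in the sample, [m] the number of positions at which both windows
    fit in [1..n], and let the regret of a guess [a] be
    [P(X_G <> a, X_D = b)] minus its infimum over all guesses.  As the copy [Y]
    is independent of the sample, the term of index [b] of the excess risk is
    the mean regret of the guess that the estimator selects
    ([excess_risk_le]), and regrets never exceed [beta_coef].  The selected
    guess maximizes [N] and [E N(a) = m P(X_G = a, X_D = b)], hence [m] times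
    its regret is at most the spread [Z = sup (dev a - dev a')] of the
    deviations [dev a = N(a) - E N(a)] ([regret_le_spread]).  It remains to
    control one random variable, [Z], which is Lipschitz for the Hamming
    distance on samples with constant [L = 2 (|G| + |D|)].

    Concentration of Lipschitz functions ([mgf_sample_le],
    [variance_sample_le]).  The successive pasts of the process form a Markov
    chain with transition operator [step].  Two pasts that agree on
    their last [j] letters can be continued by the same letter with probability
    at least [1 - Var_j]; as long as this succeeds the agreement gets longer.
    With [pi_j] the product of [1 - Var_i] over [i < j] and [gamma] a lower
    bound of all these products, the expected number of later disagreements is
    at most [1 / gamma - 1 / pi_j].  The class [lipschitz_past] of functions
    with this modulus is stable under [step] ([lipschitz_past_step]), so that
    each revealed letter moves the conditional expectation of a function with
    Lipschitz constant [L] by at most [c = L / gamma].  The same holds for the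
    whole unknown past, which therefore costs just one further step.  A
    Hoeffding bound at each of the [n + 1] steps gives
    [E exp(s F) <= exp(s E F + (n + 1) s^2 c^2 / 4)], and similarly
    [Var F <= (n + 1) c^2].

    The mean of [Z] ([mean_spread_le]).  A union bound over the guesses would
    cost a logarithm, and is meaningless on an infinite alphabet.  Instead, for
    every choice of signs the combination [sum_a (+-) N(a)] is again
    [L]-Lipschitz, so its variance is at most [(n + 1) c^2]; averaging over the
    signs, the variances of all the [N(a)] add up to at most [(n + 1) c^2].
    Since [Z^2 <= 4 sum_a (dev a)^2], this gives [E Z <= 2 c sqrt(n + 1)].

    Conclusion.  The mean regret is at most [E Z / m = O(1 / sqrt n)], which is
    eventually below [1/2 sqrt(log n / n)].  On the other hand a positive regret
    is at least the margin [delta], so that the regret is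
    at most [exp(s (Z - m delta))] for every [s >= 0]; with the best [s], the
    mean regret is at most [exp(- (m delta - E Z)^2 / ((n + 1) c^2))].  When
    [n delta^2] tends to infinity, [E Z] is negligible with respect to
    [m delta] and [m] is equivalent to [n], so that the exponent is about twice
    the one required. *)

(** * Exponential inequalities and bounded random variables *)

Section RealInequalities.
Context {R : realType}.
Implicit Types x t q : R.

Lemma ge0_derive_ge (f f' : R -> R) x :
  (forall y, is_derive y (1 : R) f (f' y)) ->
  (forall y, 0 <= y -> 0 <= f' y) -> 0 <= x -> f 0 <= f x.
Proof.
move=> df f'_ge0 x_ge0.
have f_cont : {within `[0, x], continuous f}.
  apply: derivable_within_continuous => y _.
  by have [] := df y.
have [y yI fE] := MVT_segment x_ge0 (fun y _ => df y) f_cont.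
rewrite -subr_ge0 fE subr0 mulr_ge0// f'_ge0//.
by move: yI; rewrite in_itv /= => /andP[].
Qed.

Lemma sinh_le_xcosh x : 0 <= x ->
  expR x - expR (- x) <= x * (expR x + expR (- x)).
Proof.
move=> x_ge0; rewrite -subr_ge0.
pose f := fun y : R => y * (expR y + expR (- y)) - (expR y - expR (- y)).
have df y : is_derive y (1 : R) f (y * (expR y - expR (- y))).
  rewrite /f; apply: is_derive_eq; rewrite /GRing.scale /=; ring.
have := ge0_derive_ge df _ x_ge0; rewrite /f oppr0 expR0 mul0r subrr subr0.
apply => y y_ge0; rewrite mulr_ge0// subr_ge0 ler_expR; lra.
Qed.

(** The quotient [cosh x / exp(x^2 / 2)] is nonincreasing for [0 <= x], because
    [sinh x <= x cosh x]. *)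
Lemma cosh_le_expR x : (expR x + expR (- x)) / 2 <= expR (x ^+ 2 / 2).
Proof.
wlog x_ge0 : x / 0 <= x.
  move=> H; have [/H//|x_lt0] := leP 0 x.
  by rewrite addrC -{2}[x]opprK -sqrrN; apply: H; rewrite oppr_ge0 ltW.
pose f := fun y : R =>
  - ((expR y + expR (- y)) * expR (- (2^-1 * (y * y)))).
have df y : is_derive y (1 : R) f ((y * (expR y + expR (- y)) -
    (expR y - expR (- y))) * expR (- (2^-1 * (y * y)))).
  rewrite /f; apply: is_derive_eq; rewrite /GRing.scale /=; lra.
have := ge0_derive_ge df _ x_ge0; rewrite /f oppr0 !mulr0 oppr0 expR0 mulr1.
rewrite lerN2 [expR (- (2^-1 * _))]expRN => le2; have {}le2 := le2 _.
have {}le2 : (expR x + expR (- x)) / expR (2^-1 * (x * x)) <= 1 + 1.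
  by apply: le2 => y y_ge0; rewrite mulr_ge0 ?expR_ge0// subr_ge0 sinh_le_xcosh.
rewrite ler_pdivrMr// mulrC -ler_pdivrMr ?expR_gt0//.
by rewrite expr2 [_ / 2]mulrC.
Qed.

(** Chord above a convex function, from the two tangent inequalities at [q t]. *)
Lemma expR_chord q t : 0 <= q <= 1 -> expR (q * t) <= 1 - q + q * expR t.
Proof.
move=> /andP[q_ge0 q_le1].
have tangent y : expR (q * t) * (1 + (y - q * t)) <= expR y.
  have /(ler_wpM2l (expR_ge0 (q * t))) := expR_ge1Dx (y - q * t).
  by rewrite -expRD [q * t + _]addrC subrK.
have := ler_wpM2l q_ge0 (tangent t).
have /(ler_wpM2l (_ : 0 <= 1 - q)) := tangent 0.
rewrite subr_ge0 expR0 => /(_ q_le1).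
set E := expR _; set F := expR t; nra.
Qed.

(** Symmetrization: multiplying the moment generating function at [t] of a
    centred Bernoulli variable by the one at [- t], which is at least [1], gives
    that of the difference of two copies.  The latter is at most
    [cosh (t / 2) ^ 2].  The constant [1/4] loses a factor [2] with respect to
    the optimal [1/8]; the rates below leave room for it. *)
Lemma bernoulli_mgf_le q t : 0 <= q <= 1 ->
  1 - q + q * expR t <= expR (q * t + t ^+ 2 / 4).
Proof.
move=> /andP[q_ge0 q_le1].
have mgfN_ge1 : 1 <= expR (q * t) * (1 - q + q * expR (- t)).
  rewrite mulrDr mulrCA -expRD.
  have /(ler_wpM2l (_ : 0 <= 1 - q)) := expR_ge1Dx (q * t).
  rewrite subr_ge0 => /(_ q_le1).
  have /(ler_wpM2l q_ge0) := expR_ge1Dx (q * t + - t); lra.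
have mgf_ge0 : 0 <= 1 - q + q * expR t.
  by rewrite addr_ge0 ?subr_ge0// mulr_ge0// expR_ge0.
have prod_le : (1 - q + q * expR t) * (1 - q + q * expR (- t)) <=
    expR (t ^+ 2 / 4).
  have -> : t ^+ 2 / 4 = (t / 2) ^+ 2 / 2 + (t / 2) ^+ 2 / 2 by lra.
  rewrite expRD.
  have cosh_ge0 : 0 <= (expR (t / 2) + expR (- (t / 2))) / 2.
    by rewrite divr_ge0// addr_ge0// expR_ge0.
  apply: le_trans (ler_pM cosh_ge0 cosh_ge0 (cosh_le_expR _) (cosh_le_expR _)).
  have tE : expR t = expR (t / 2) * expR (t / 2).
    by rewrite -expRD; congr expR; lra.
  have tNE : expR (- t) = expR (- (t / 2)) * expR (- (t / 2)).
    by rewrite -expRD; congr expR; lra.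
  have xy1 : expR (t / 2) * expR (- (t / 2)) = 1 by rewrite expRxMexpNx_1.
  move: xy1 tE tNE.
  set u := expR (t / 2); set v := expR (- (t / 2)) => xy1 -> ->.
  have -> : (1 - q + q * (u * u)) * (1 - q + q * (v * v)) =
      1 + q * (1 - q) * (u - v) ^+ 2.
    transitivity ((1 - q) ^+ 2 + q * (1 - q) * (u * u + v * v) +
      q ^+ 2 * (u * v) ^+ 2); first by ring.
    transitivity (1 + q * (1 - q) * (u * u + v * v - 2 * (u * v))).
      by rewrite xy1; ring.
    by ring.
  have -> : (u + v) / 2 * ((u + v) / 2) = 1 + 4^-1 * (u - v) ^+ 2.
    transitivity (u * v + 4^-1 * (u - v) ^+ 2); last by rewrite xy1.
    by lra.
  rewrite lerD2l ler_wpM2r ?sqr_ge0//.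
  by have := sqr_ge0 (q - 2^-1); lra.
rewrite expRD; apply: le_trans (ler_wpM2l (expR_ge0 _) prod_le).
by rewrite mulrCA ler_peMr.
Qed.

End RealInequalities.

Section BoundedExpectation.
Context {d} {T : measurableType d} {R : realType}.
Variable Q : {measure set T -> \bar R}.
Hypothesis Q1 : Q [set: T] = 1%E.
Implicit Types g h : T -> R.

Definition bounded_measurable g :=
  measurable_fun [set: T] g /\ exists M, forall x, `|g x| <= M.

Lemma bounded_measurable_integrable g :
  bounded_measurable g -> Q.-integrable [set: T] (EFin \o g).
Proof.
move=> [mg [M gM]]; apply: measurable_bounded_integrable => //.
  by rewrite Q1 ltry.
exists M; split; first exact: num_real.
by move=> N MN x _; apply: le_trans (gM x) (ltW MN).
Qed.

Lemma mean_cst (r : R) : \int[Q]_x r = r.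
Proof. by rewrite Rintegral_cst// Q1 mulr1. Qed.

Lemma mean_le g h : bounded_measurable g -> bounded_measurable h ->
  (forall x, g x <= h x) -> \int[Q]_x g x <= \int[Q]_x h x.
Proof. by move=> bg bh gh; apply: le_Rintegral => //; exact: bounded_measurable_integrable. Qed.

Lemma meanD g h : bounded_measurable g -> bounded_measurable h ->
  \int[Q]_x (g x + h x) = \int[Q]_x g x + \int[Q]_x h x.
Proof. by move=> bg bh; apply: RintegralD => //; exact: bounded_measurable_integrable. Qed.

Lemma meanZ g (r : R) : bounded_measurable g ->
  \int[Q]_x (r * g x) = r * \int[Q]_x g x.
Proof. by move=> bg; apply: RintegralZl => //; exact: bounded_measurable_integrable. Qed.

Lemma EFin_mean g : bounded_measurable g ->
  (\int[Q]_x g x)%:E = (\int[Q]_x (g x)%:E)%E.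
Proof.
by move=> bg; rewrite fineK//; apply/integrable_fin_num/bounded_measurable_integrable.
Qed.

End BoundedExpectation.

Section BoundedMeasurable.
Context {d} {T : measurableType d} {R : realType}.
Implicit Types g h : T -> R.

Lemma bounded_measurable_cst (r : R) : bounded_measurable (fun _ : T => r).
Proof. by split=> //; exists `|r|. Qed.

Lemma bounded_measurableD g h : bounded_measurable g -> bounded_measurable h ->
  bounded_measurable (fun x => g x + h x).
Proof.
move=> [mg [M gM]] [mh [N hN]]; split; first exact: measurable_funD.
by exists (M + N) => x; rewrite (le_trans (ler_normD _ _))// lerD.
Qed.

Lemma bounded_measurableZ g (r : R) : bounded_measurable g ->
  bounded_measurable (fun x => r * g x).
Proof.
move=> [mg [M gM]]; split; first exact: measurable_funM.
by exists (`|r| * M) => x; rewrite normrM ler_wpM2l//.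
Qed.

Lemma bounded_measurableX g : bounded_measurable g ->
  bounded_measurable (fun x => g x ^+ 2).
Proof.
move=> [mg [M gM]]; split; first exact: measurable_funX.
exists (M ^+ 2) => x; rewrite normrX lerXn2r ?nnegrE//.
exact: le_trans (gM x).
Qed.

Lemma bounded_measurable_expR g (s : R) : bounded_measurable g ->
  bounded_measurable (fun x => expR (s * g x)).
Proof.
move=> bg; have [mg [M gM]] := bounded_measurableZ s bg; split.
  exact: measurableT_comp.
exists (expR M) => x; rewrite ger0_norm ?expR_ge0// ler_expR.
exact: le_trans (ler_norm _) (gM x).
Qed.

End BoundedMeasurable.

Section Concentration.
Context {d} {T : measurableType d} {R : realType}.
Variable Q : {measure set T -> \bar R}.
Hypothesis Q1 : Q [set: T] = 1%E.
Variables (h : T -> R) (c : R).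
Hypothesis bh : bounded_measurable h.
Hypothesis c_gt0 : 0 < c.
Hypothesis osc_h : forall x y, h x - h y <= c.

(** Hoeffding's lemma: below the chord of the exponential over the range of [h],
    the worst case is a Bernoulli variable. *)
Lemma mgf_le_osc (s : R) :
  \int[Q]_x expR (s * h x) <= expR (s * \int[Q]_x h x + s ^+ 2 * c ^+ 2 / 4).
Proof.
pose l := inf (range h).
have [M hM] : exists M, forall x, `|h x| <= M by case: bh.
have lb_l : has_lbound (range h).
  by exists (- M) => _ [x _ <-]; have := hM x; rewrite ler_norml => /andP[].
have l_le x : l <= h x by apply: ge_inf => //; exists x.
have le_l x : h x <= l + c.
  rewrite -lerBlDr; apply: lb_le_inf; first by exists (h x), x.
  by move=> _ [y _ <-]; have := osc_h x y; lra.
pose q := (\int[Q]_x h x - l) / c.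
have l_mean : l <= \int[Q]_x h x.
  rewrite -[leLHS](mean_cst Q1); apply: mean_le => //.
  exact: bounded_measurable_cst.
have mean_l : \int[Q]_x h x <= l + c.
  rewrite -[leRHS](mean_cst Q1); apply: mean_le => //.
  exact: bounded_measurable_cst.
have q01 : 0 <= q <= 1.
  rewrite /q divr_ge0 ?subr_ge0 ?(ltW c_gt0)//=.
  by rewrite ler_pdivrMr// mul1r lerBlDl.
pose u x := (h x - l) / c.
have u01 x : 0 <= u x <= 1.
  rewrite divr_ge0 ?subr_ge0 ?(ltW c_gt0)//=.
  by rewrite ler_pdivrMr// mul1r lerBlDl.
have huE x : h x = l + c * u x by rewrite mulrCA divff ?mulr1 1?addrC ?subrK ?gt_eqF.
pose k := expR (s * l) * (expR (s * c) - 1) / c.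
have chord x : expR (s * h x) <= expR (s * l) - k * l + k * h x.
  rewrite {1}huE mulrDr expRD.
  have := ler_wpM2l (expR_ge0 (s * l)) (expR_chord (s * c) (u01 x)).
  rewrite [u x * _]mulrC -mulrA => /le_trans; apply.
  rewrite [h x]huE /k; set U := u x; set E := expR (s * l); set F := expR _.
  suff -> : E * (F - 1) / c * (l + c * U) = E * (F - 1) / c * l + E * (F - 1) * U.
    by lra.
  by field; rewrite gt_eqF.
apply: (@le_trans _ _ (expR (s * l) - k * l + k * \int[Q]_x h x)).
  rewrite -(meanZ Q1)// -[expR (s * l) - k * l](mean_cst Q1) -(meanD Q1)//.
  - apply: mean_le => //; first exact: bounded_measurable_expR.
    apply: bounded_measurableD; first exact: bounded_measurable_cst.
    exact: bounded_measurableZ.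
  - exact: bounded_measurable_cst.
  - exact: bounded_measurableZ.
have meanE : \int[Q]_x h x = l + c * q.
  by rewrite mulrCA divff ?mulr1 1?addrC ?subrK ?gt_eqF.
have -> : expR (s * l) - k * l + k * \int[Q]_x h x =
    expR (s * l) * (1 - q + q * expR (s * c)).
  by rewrite meanE /k; field; rewrite gt_eqF.
have -> : s * \int[Q]_x h x + s ^+ 2 * c ^+ 2 / 4 =
    s * l + (q * (s * c) + (s * c) ^+ 2 / 4) by rewrite meanE; lra.
by rewrite expRD ler_wpM2l ?expR_ge0// bernoulli_mgf_le.
Qed.

(** The mean of [h] is within [c] of each of its values. *)
Lemma second_moment_le_osc (r : R) :
  \int[Q]_x (h x - r) ^+ 2 <= (\int[Q]_x h x - r) ^+ 2 + c ^+ 2.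
Proof.
set m := \int[Q]_x h x.
have mean_near x : `|h x - m| <= c.
  rewrite ler_norml; apply/andP; split.
    rewrite lerBrDl -lerBrDr opprK -[leRHS](mean_cst Q1); apply: mean_le => //.
      exact: bounded_measurable_cst.
    by move=> y; have := osc_h y x; lra.
  rewrite lerBlDr -lerBlDl -[leLHS](mean_cst Q1); apply: mean_le => //.
    exact: bounded_measurable_cst.
  by move=> y; have := osc_h x y; lra.
have sqE x : (h x - r) ^+ 2 = (h x - m) ^+ 2 + (m - r) * (2 * h x - m - r).
  by ring.
have sq_le x : (h x - r) ^+ 2 <=
    c ^+ 2 - (m - r) * (m + r) + 2 * (m - r) * h x.
  rewrite sqE; have : (h x - m) ^+ 2 <= c ^+ 2.
    by rewrite -real_normK ?num_real// lerXn2r ?nnegrE ?(ltW c_gt0).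
  by lra.
have -> : (m - r) ^+ 2 + c ^+ 2 = c ^+ 2 - (m - r) * (m + r) + 2 * (m - r) * m.
  by ring.
rewrite -{6}/m -(meanZ Q1)// -[X in _ <= X + _](mean_cst Q1) -(meanD Q1)//.
- apply: mean_le => //.
    apply/bounded_measurableX/bounded_measurableD => //.
    exact: bounded_measurable_cst.
  apply: bounded_measurableD; first exact: bounded_measurable_cst.
  exact: bounded_measurableZ.
- exact: bounded_measurable_cst.
- exact: bounded_measurableZ.
Qed.

End Concentration.

Section SumOfMeans.
Context {d} {T : measurableType d} {R : realType}.
Variable Q : {measure set T -> \bar R}.
Hypothesis Q1 : Q [set: T] = 1%E.

Lemma bounded_measurable_sum (I : Type) (s : seq I) (g : I -> T -> R) :
  (forall i, bounded_measurable (g i)) ->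
  bounded_measurable (fun x => \sum_(i <- s) g i x).
Proof.
move=> bg; elim: s => [|i s IHs].
  under eq_fun do rewrite big_nil; exact: bounded_measurable_cst.
under eq_fun do rewrite big_cons; exact: bounded_measurableD.
Qed.

Lemma mean_sum (I : Type) (s : seq I) (g : I -> T -> R) :
  (forall i, bounded_measurable (g i)) ->
  \int[Q]_x (\sum_(i <- s) g i x) = \sum_(i <- s) \int[Q]_x g i x.
Proof.
move=> bg; elim: s => [|i s IHs].
  by rewrite big_nil -[RHS](mean_cst Q1); apply: eq_Rintegral => x _; rewrite big_nil.
rewrite big_cons -IHs -(meanD Q1)//; last exact: bounded_measurable_sum.
by apply: eq_Rintegral => x _; rewrite big_cons.
Qed.

(** Averaging over signs one coordinate at a time, by the parallelogram
    identity for [u + y i] and [u - y i].  The bound for signed sums is stated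
    for all coefficients in [[-1, 1]], and [u] stands for the signed terms
    already removed. *)
Lemma sum_second_moment_le (I : eqType) (s : seq I) (y : I -> T -> R)
    (u : T -> R) (V : R) : uniq s ->
  (forall i, bounded_measurable (y i)) -> bounded_measurable u ->
  (forall e : I -> R, (forall i, `|e i| <= 1) ->
    \int[Q]_x (u x + \sum_(i <- s) e i * y i x) ^+ 2 <= V) ->
  \int[Q]_x u x ^+ 2 + \sum_(i <- s) \int[Q]_x y i x ^+ 2 <= V.
Proof.
move=> + by_; elim: s u => [|i s IHs] u /=.
  move=> _ bu /(_ (fun=> 0)) le_V; rewrite big_nil addr0.
  apply: le_trans (le_V _); last by move=> i; rewrite normr0 ler01.
  rewrite le_eqVlt; apply/orP; left; apply/eqP.
  by apply: eq_Rintegral => x _; rewrite big_nil addr0.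
move=> /andP[i_notin uniq_s] bu le_V.
have signed (r : R) : `|r| <= 1 -> bounded_measurable (fun x => u x + r * y i x) ->
    \int[Q]_x (u x + r * y i x) ^+ 2 + \sum_(i <- s) \int[Q]_x y i x ^+ 2 <= V.
  move=> r_le1 bur; apply: IHs => // e e_le1.
  apply: le_trans (le_V (fun k => if k == i then r else e k) _); last first.
    by move=> k; case: ifP.
  rewrite le_eqVlt; apply/orP; left; apply/eqP.
  apply: eq_Rintegral => x _; rewrite big_cons eqxx addrA.
  congr ((_ + _) ^+ 2); apply: eq_big_seq => k ks.
  by case: eqP => // ki; move: i_notin; rewrite -ki ks.
have bur r : bounded_measurable (fun x => u x + r * y i x).
  exact/bounded_measurableD/bounded_measurableZ.
have := signed 1 _ (bur 1); have := signed (-1) _ (bur (-1)).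
rewrite normrN normr1 => /(_ (lexx _)) leN /(_ (lexx _)) leP.
have : \int[Q]_x (u x + 1 * y i x) ^+ 2 + \int[Q]_x (u x + -1 * y i x) ^+ 2 =
    2 * (\int[Q]_x u x ^+ 2 + \int[Q]_x y i x ^+ 2).
  have bsqu := bounded_measurableX bu.
  have bsqy := bounded_measurableX (by_ i).
  rewrite -(meanD Q1 (bounded_measurableX (bur 1)) (bounded_measurableX (bur (-1)))).
  rewrite -(meanD Q1 bsqu bsqy) -(meanZ Q1 _ (bounded_measurableD bsqu bsqy)).
  by apply: eq_Rintegral => x _; ring.
by rewrite big_cons; lra.
Qed.

End SumOfMeans.

(** * Laws on a countable alphabet *)

(** Alphabets carry the discrete sigma-algebra, for which every function is
    measurable. *)
Definition letter_space (A : pointedType) := g_sigma_algebraType [set: set A].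

Lemma measurable_letters (A : pointedType) (S : set (letter_space A)) : measurable S.
Proof. exact: sub_gen_smallest. Qed.

Lemma measurable_fun_letters (A : pointedType) d (T : measurableType d)
    (g : letter_space A -> T) : measurable_fun setT g.
Proof. by move=> _ S _; exact: measurable_letters. Qed.

Lemma countable_decode (T : Type) (t0 : T) : countable [set: T] ->
  exists (code : T -> nat) (decode : nat -> T), cancel code decode.
Proof.
move=> /countable_injP[code code_inj].
pose decode k := if pselect (exists t, code t = k) is left tk
  then projT1 (cid tk) else t0.
exists code, decode => t; rewrite /decode; case: pselect => [tk|[]]; last by exists t.
by apply: code_inj; rewrite ?inE//; case: (cid tk).
Qed.

Section LetterLaw.
Context {R : realType} {A : pointedType}.
Variables (code : A -> nat) (decode : nat -> A).
Hypothesis codeK : cancel code decode.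
Implicit Types w : A -> R.

Definition is_code (k : nat) := code (decode k) == k.

(** Gives access to the convergence theorems for series of integrals; [is_code]
    discards the default values of [decode]. *)
Lemma esum_decode (h : A -> \bar R) : (forall a, (0 <= h a)%E) ->
  (\esum_(a in [set: A]) h a = \sum_(k <oo | is_code k) h (decode k))%E.
Proof.
move=> h_ge0; rewrite -esum_pred_image//; last first.
  move=> k l; rewrite !inE => /eqP kE /eqP lE kl.
  by rewrite -kE -lE kl.
congr esum; apply/seteqP; split=> // a _.
by exists (code a); rewrite /is_code ?inE codeK.
Qed.

(** The absolute value packs the weight as a nonnegative number whatever [w]
    is; for a mass function it has no effect. *)
Definition letter_law w : {measure set (letter_space A) -> \bar R} :=
  mseries (fun k =>
    mscale (`|if is_code k then w (decode k) else 0|)%:nng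
      (\d_ (decode k : letter_space A))) 0.

Lemma integral_letter_law w (h : A -> \bar R) :
  (forall a, 0 <= w a) -> (forall a, (0 <= h a)%E) ->
  (\int[letter_law w]_(a in [set: letter_space A]) h a =
   \esum_(a in [set: A]) ((w a)%:E * h a))%E.
Proof.
move=> w_ge0 h_ge0.
have mh : measurable_fun [set: letter_space A] h by exact: measurable_fun_letters.
rewrite ge0_integral_measure_series// esum_decode; last first.
  by move=> a; rewrite mule_ge0 ?lee_fin.
rewrite [RHS]eseries_mkcond; apply: eq_eseriesr => k _.
rewrite ge0_integral_mscale// integral_dirac// diracT mul1e /=.
by case: ifPn => _; rewrite ?normr0 ?mul0e// ger0_norm.
Qed.

Lemma letter_law_setT w : (forall a, 0 <= w a) ->
  (\esum_(a in [set: A]) (w a)%:E = 1)%E ->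
  letter_law w [set: letter_space A] = 1%E.
Proof.
move=> w_ge0 w1.
have := @integral_letter_law w (cst 1%E) w_ge0 (fun=> lee01).
rewrite integral_cst// mul1e => ->.
by under eq_esum do rewrite mule1.
Qed.

(** Total variation controls the difference of two means: subtracting the
    midpoint of [[lo, hi]] from [g] changes both means equally and leaves a
    function bounded by [(hi - lo) / 2]. *)
Lemma letter_law_mean_le w w' (g : A -> R) (lo hi v : R) :
  (forall a, 0 <= w a) -> (\esum_(a in [set: A]) (w a)%:E = 1)%E ->
  (forall a, 0 <= w' a) -> (\esum_(a in [set: A]) (w' a)%:E = 1)%E ->
  ((2^-1)%:E * (\esum_(a in [set: A]) `|w a - w' a|%:E) <= v%:E)%E ->
  (forall a, lo <= g a <= hi) ->
  \int[letter_law w]_a g a <= \int[letter_law w']_a g a + v * (hi - lo).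
Proof.
move=> w_ge0 w1 w'_ge0 w'1 tv_le g_bd.
have mass := letter_law_setT w_ge0 w1; have mass' := letter_law_setT w'_ge0 w'1.
pose u a := g a - lo.
have u_ge0 a : 0 <= u a by rewrite subr_ge0; have /andP[] := g_bd a.
have u_le a : u a <= hi - lo by rewrite lerB//; have /andP[] := g_bd a.
have len_ge0 : 0 <= hi - lo by apply: le_trans (u_ge0 point) (u_le point).
have bu : bounded_measurable (u : letter_space A -> R).
  split; first exact: measurable_fun_letters.
  by exists (hi - lo) => a; rewrite ger0_norm.
have gE (Q : {measure set (letter_space A) -> \bar R}) : Q setT = 1%E ->
    \int[Q]_a g a = \int[Q]_a u a + lo.
  move=> Q1; rewrite -[X in _ + X](mean_cst Q1) -(meanD Q1)//.
    by apply: eq_Rintegral => a _; rewrite subrK.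
  exact: bounded_measurable_cst.
rewrite !gE// addrAC lerD2r -lee_fin EFinD !EFin_mean//.
rewrite !integral_letter_law//.
set S := (\esum_(a in _) `|_|%:E)%E in tv_le.
pose len2 := (hi - lo) / 2.
have len2_ge0 : 0 <= len2 by rewrite divr_ge0.
have esumZ (k : R) (h : A -> R) : 0 <= k -> (forall a, 0 <= h a) ->
    (\esum_(a in [set: A]) (k * h a)%:E =
     k%:E * (\esum_(a in [set: A]) (h a)%:E))%E.
  move=> k_ge0 h_ge0.
  rewrite !esum_decode; try (by move=> a; rewrite lee_fin ?mulr_ge0).
  rewrite -nneseriesZl => [|i _]; last by rewrite lee_fin.
  by apply: eq_eseriesr => i _; rewrite EFinM.
have termwise : ((\esum_(a in [set: A]) ((w a)%:E * (u a)%:E)) +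
    (\esum_(a in [set: A]) (len2 * w' a)%:E) <=
    (\esum_(a in [set: A]) ((w' a)%:E * (u a)%:E)) +
    ((\esum_(a in [set: A]) (len2 * w a)%:E) +
     (\esum_(a in [set: A]) (len2 * `|w a - w' a|)%:E)))%E.
  rewrite -!esumD; try (by move=> a _; rewrite -?EFinM -?EFinD lee_fin
    ?addr_ge0 ?mulr_ge0).
  apply: le_esum => a _; rewrite -!EFinM -!EFinD lee_fin.
  have : (w a - w' a) * (u a - len2) <= `|w a - w' a| * len2.
    apply: le_trans (ler_norm _) _; rewrite normrM ler_wpM2l//.
    rewrite ler_norml; have := u_ge0 a; have := u_le a.
    by rewrite /len2 => *; apply/andP; split; lra.
  by lra.
rewrite !esumZ// w1 w'1 mule1 in termwise.
have tvS : (len2%:E * S <= (v * (hi - lo))%:E)%E.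
  have -> : len2%:E = ((hi - lo)%:E * (2^-1)%:E)%E by rewrite -EFinM.
  by rewrite -muleA [v * _]mulrC EFinM lee_wpmul2l// lee_fin.
rewrite -(@leeD2rE _ len2%:E)//; apply: le_trans termwise _.
by rewrite -addeA leeD2l// addeC leeD2r.
Qed.

End LetterLaw.

(** * Integrals against two weights that agree on preimages *)

Section WeightedTransfer.
Context {d1 d2} {X : measurableType d1} {Y : measurableType d2} {R : realType}.
Variables (Q : {measure set X -> \bar R}) (phi : X -> Y).
Hypothesis mphi : measurable_fun [set: X] phi.

Import HBNNSimple.

Let measurable_phi_preimage (B : set Y) :
  measurable B -> measurable (phi @^-1` B).
Proof. by move=> mB; rewrite -[X in measurable X]setTI; exact: mphi. Qed.

Let integral_weight_nnsfun (u : X -> R) (h : {nnsfun Y >-> R}) :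
  measurable_fun [set: X] u -> (forall x, 0 <= u x) ->
  (\int[Q]_x (u x * h (phi x))%:E =
   \sum_(r \in range h) r%:E * \int[Q]_(x in phi @^-1` (h @^-1` [set r])) (u x)%:E)%E.
Proof.
move=> mu u_ge0.
have mind r : measurable_fun [set: X] (fun x => \1_(h @^-1` [set r]) (phi x) : R).
  exact: measurableT_comp.
transitivity (\sum_(r \in range h) \int[Q]_x
    (r * (\1_(h @^-1` [set r]) (phi x) * u x))%:E)%E.
  under eq_integral => x _.
    rewrite fimfunE mulrC mulr_fsuml// -fsumEFin//.
    under eq_fsbigr do rewrite -mulrA.
    over.
  rewrite ge0_integral_fsum//.
    by move=> r; apply/measurable_EFinP/measurable_funM => //; exact: measurable_funM.
  move=> r x _; rewrite lee_fin mulrA mulr_ge0//.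
  by have := nnfun_muleindic_ge0 h r (phi x); rewrite -EFinM lee_fin.
apply: eq_fsbigr => r rh.
have r_ge0 : 0 <= r by move: rh; rewrite inE => -[y _ <-].
rewrite [in RHS]integral_mkcond.
rewrite -ge0_integralZl//; first last.
- by move=> x _; rewrite patchE; case: ifP => // _; rewrite lee_fin.
- apply/(measurable_restrictT _ _).1 => //.
    exact: measurable_phi_preimage.
  by apply/measurable_EFinP; exact: measurable_funTS.
apply: eq_integral => x _; rewrite EFinM; congr (_ * _)%E.
rewrite patchE indicE.
have -> : (x \in phi @^-1` (h @^-1` [set r])) = (phi x \in h @^-1` [set r]).
  by apply/idP/idP; rewrite !inE.
by case: ifP => _; rewrite ?mul1r ?mul0r.
Qed.

(** Both sides agree when [g] is simple, and pass to monotone limits.  It is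
    used to extend the defining property of conditional probabilities from
    events of the past to functions of the past. *)
Lemma integral_weight_transfer (u v : X -> R) (g : Y -> R) :
  measurable_fun [set: X] u -> (forall x, 0 <= u x) ->
  measurable_fun [set: X] v -> (forall x, 0 <= v x) ->
  (forall B, measurable B -> \int[Q]_(x in phi @^-1` B) (u x)%:E =
                             \int[Q]_(x in phi @^-1` B) (v x)%:E)%E ->
  measurable_fun [set: Y] g -> (forall y, 0 <= g y) ->
  (\int[Q]_x (u x * g (phi x))%:E = \int[Q]_x (v x * g (phi x))%:E)%E.
Proof.
move=> mu u_ge0 mv v_ge0 uv mg g_ge0.
have meg : measurable_fun [set: Y] (EFin \o g) by exact/measurable_EFinP.
pose g_ := nnsfun_approx measurableT meg.
have approx_cvg (w : X -> R) : measurable_fun [set: X] w ->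
    (forall x, 0 <= w x) ->
    (\int[Q]_x (w x * g_ n (phi x))%:E @[n --> \oo] -->
     \int[Q]_x (w x * g (phi x))%:E)%E.
  move=> mw w_ge0.
  have -> : (\int[Q]_x (w x * g (phi x))%:E =
      \int[Q]_x limn (fun n => (w x * g_ n (phi x))%:E))%E.
    apply: eq_integral => x _; apply/esym/cvg_lim => //.
    rewrite EFinM; under eq_fun do rewrite EFinM.
    apply: cvgeZl => //.
    by apply: (@cvg_nnsfun_approx _ _ _ _ measurableT _ meg) => // y _; rewrite lee_fin.
  apply: cvg_monotone_convergence => //.
  - move=> n; apply/measurable_EFinP/measurable_funM => //.
    exact: measurableT_comp.
  - by move=> n x _; rewrite lee_fin mulr_ge0.
  - move=> x _ m n mn; rewrite lee_fin ler_wpM2l//.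
    exact/lefP/nd_nnsfun_approx.
apply: cvg_unique (approx_cvg _ mu u_ge0) _ => //.
rewrite (_ : (fun n => _) = fun n => (\int[Q]_x (v x * g_ n (phi x))%:E)%E).
  exact: approx_cvg.
apply/funext => n; rewrite !integral_weight_nnsfun//.
apply: eq_fsbigr => r _; congr (_ * _)%E; apply: uv.
exact: measurable_sfunP.
Qed.

End WeightedTransfer.

(** * The chain of pasts *)

Section PathSpace.
Context {A : pointedType}.

Lemma measurable_coordinate (I : Type) (i : I) (B : set A) :
  measurable ([set x | B (x i)] : set (path_space I A)).
Proof. by apply: sub_gen_smallest; exists i, B. Qed.

Lemma measurable_fun_path d (T : measurableType d) (I : Type)
    (phi : T -> path_space I A) :
  (forall i (B : set A), measurable [set t | B (phi t i)]) ->
  measurable_fun [set: T] phi.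
Proof.
move=> mphi; refine (@measurability _ _ T (path_space I A) setT phi
  (@coordinate_events I A) _ _); first by [].
by move=> _ [_ [i [B ->]] <-]; rewrite setTI; exact: mphi.
Qed.

Definition cons_past (a : A) (z : path_space nat A) : path_space nat A :=
  fun k => if k is k'.+1 then z k' else a.

Lemma measurable_cons_past a : measurable_fun [set: path_space nat A] (cons_past a).
Proof.
apply: measurable_fun_path => -[|k] B /=; last exact: measurable_coordinate.
have [Ba|nBa] := pselect (B a).
  by rewrite (_ : [set _ | _] = setT)//; apply/seteqP; split.
by rewrite (_ : [set _ | _] = set0)//; apply/seteqP; split.
Qed.

Lemma measurable_past : measurable_fun [set: path_space int A] (@past A).
Proof. by apply: measurable_fun_path => k B; exact: measurable_coordinate. Qed.

Lemma measurable_shift :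
  measurable_fun [set: path_space int A] (@Defs.shift A : _ -> path_space int A).
Proof.
by apply: measurable_fun_path => i B; exact: (measurable_coordinate (i + 1)).
Qed.

Lemma cons_past_shift (x : path_space int A) :
  cons_past (x (0 : int)) (past x) = past (Defs.shift x).
Proof.
apply/funext => -[|k] /=; rewrite /past /Defs.shift; first by congr x.
by congr x; rewrite !NegzE -[in RHS](addn1 k.+1) PoszD opprD subrK.
Qed.

End PathSpace.

Section PastChain.
Context {R : realType} {A : pointedType}.
Variables (code : A -> nat) (decode : nat -> A).
Hypothesis codeK : cancel code decode.
Variable P : probability (path_space int A) R.
Hypothesis P_stationary : stationary P.
Variable p : A -> path_space nat A -> R.
Hypothesis p_version : left_conditional_version P p.
Implicit Types g h : path_space nat A -> R.

Let p_ge0 a z : 0 <= p a z. Proof. by have [] := p_version. Qed.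
Let p_sum1 z : (\esum_(a in [set: A]) (p a z)%:E = 1)%E.
Proof. by have [] := p_version. Qed.
Let measurable_p a : measurable_fun [set: path_space nat A] (p a).
Proof. by have [] := p_version. Qed.

Definition next_law z := letter_law code decode (p^~ z).

(** Transition operator of the chain of pasts: [step g z] is the conditional
    expectation of [g] at the next past, given that the current past is [z]. *)
Definition step (g : path_space nat A -> R) z : R :=
  \int[next_law z]_a g (cons_past a z).

Lemma next_law_setT z : next_law z setT = 1%E.
Proof. exact: letter_law_setT. Qed.

Lemma bounded_cons_past (g : path_space nat A -> R) z :
  bounded_measurable g ->
  bounded_measurable (fun a : letter_space A => g (cons_past a z)).
Proof.
move=> [_ [M gM]]; split; first exact: measurable_fun_letters.
by exists M => a; exact: gM.
Qed.

Lemma stepD g h z : bounded_measurable g -> bounded_measurable h ->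
  step (fun y : path_space nat A => g y + h y) z = step g z + step h z.
Proof.
by move=> bg bh; apply: (meanD (next_law_setT z)); exact: bounded_cons_past.
Qed.

Lemma step_cst r z : step (fun=> r) z = r.
Proof. exact: (mean_cst (next_law_setT z)). Qed.

Lemma step_norm_le g M : bounded_measurable g -> (forall z, `|g z| <= M) ->
  forall z, `|step g z| <= M.
Proof.
move=> bg gM z; have bgz := bounded_cons_past z bg.
have cstM r : bounded_measurable (fun _ : letter_space A => r : R).
  exact: bounded_measurable_cst.
rewrite ler_norml -{1}[- M](step_cst _ z) -[X in _ && (_ <= X)](step_cst M z).
apply/andP; split; apply: (mean_le (next_law_setT z)) => // a.
- by have := gM (cons_past a z); rewrite ler_norml => /andP[].
- by have := gM (cons_past a z); rewrite ler_norml => /andP[].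
Qed.

Let step_series g z : (forall y, 0 <= g y) -> bounded_measurable g ->
  ((step g z)%:E =
   \sum_(k <oo | is_code code decode k)
     (p (decode k) z * g (cons_past (decode k) z))%:E)%E.
Proof.
move=> g_ge0 bg; rewrite (EFin_mean (next_law_setT z)); last first.
  exact: bounded_cons_past.
rewrite (integral_letter_law codeK)//; last by move=> a; rewrite lee_fin.
rewrite (esum_decode codeK); last by move=> a; rewrite mule_ge0// lee_fin.
by apply: eq_eseriesr => k _; rewrite EFinM.
Qed.

Let measurable_summand g k : bounded_measurable g ->
  measurable_fun [set: path_space nat A]
    (fun z => p (decode k) z * g (cons_past (decode k) z)).
Proof.
move=> [mg _]; apply: measurable_funM; first exact: measurable_p.
by apply: measurableT_comp => //; exact: measurable_cons_past.
Qed.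

Let bounded_measurable_lift (g : path_space nat A -> R) : bounded_measurable g ->
  exists M, (forall z, 0 <= g z + M) /\ bounded_measurable (fun z : path_space nat A => g z + M).
Proof.
move=> bg; have [_ [M gM]] := bg; exists M; split.
  by move=> z; have := gM z; rewrite ler_norml -subr_ge0 opprK => /andP[].
by apply: bounded_measurableD => //; exact: bounded_measurable_cst.
Qed.

Let step_lift g M z : bounded_measurable g ->
  step (fun y : path_space nat A => g y + M) z = step g z + M.
Proof.
by move=> bg; rewrite stepD ?step_cst//; exact: bounded_measurable_cst.
Qed.

Lemma bounded_measurable_step g : bounded_measurable g ->
  bounded_measurable (step g).
Proof.
move=> bg; have [_ [M' gM']] := bg; split; last first.
  by exists M'; exact: step_norm_le.
have [M [gM_ge0 bgM]] := bounded_measurable_lift bg.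
have -> : step g = (fun z => step (fun y : path_space nat A => g y + M) z - M).
  by apply/funext => z; rewrite step_lift// addrK.
apply: measurable_funB => //; apply/measurable_EFinP.
rewrite (_ : _ \o _ = fun z => (\sum_(k <oo | k \in is_code code decode)
    (p (decode k) z * (g (cons_past (decode k) z) + M))%:E)%E); last first.
  by apply/funext => z /=; exact: step_series.
apply: ge0_emeasurable_sum => [k z _ _|k _].
  by rewrite lee_fin mulr_ge0.
by apply/measurable_EFinP; exact: measurable_summand bgM.
Qed.

Lemma integral_shift (g : path_space int A -> R) :
  measurable_fun setT g -> (forall x, 0 <= g x) ->
  (\int[P]_x (g (Defs.shift x))%:E = \int[P]_x (g x)%:E)%E.
Proof.
move=> mg g_ge0.
have := @ge0_integral_pushforward _ _ _ _ R _ measurable_shift P setT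
  (EFin \o g) measurableT.
rewrite preimage_setT => <- //; first last.
- by move=> y _; rewrite /= lee_fin.
- exact/measurable_EFinP.
apply: eq_measure_integral; first exact: measurable_shift.
by move=> ? B mB _; exact: P_stationary.
Qed.

Let first_letter_indic a :
  (fun x : path_space int A => (x (0 : int) == a)%:R : R) =
  \1_[set x : path_space int A | x (0 : int) = a].
Proof.
apply/funext => x; rewrite indicE.
by case: eqP => xa; [rewrite mem_set|rewrite memNset].
Qed.

Let measurable_first_letter a : measurable_fun [set: path_space int A]
  (fun x : path_space int A => (x (0 : int) == a)%:R : R).
Proof.
rewrite first_letter_indic; apply: measurable_indic.
exact: (@measurable_coordinate A _ (0 : int) [set a]).
Qed.

Let integral_conditional a (g : path_space nat A -> R) :
  measurable_fun setT g -> (forall z, 0 <= g z) ->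
  (\int[P]_x (p a (past x) * g (past x))%:E =
   \int[P]_x ((x (0 : int) == a)%:R * g (past x))%:E)%E.
Proof.
move=> mg g_ge0.
have meqf := measurable_first_letter a.
have := @integral_weight_transfer _ _ _ _ R P (@past A) measurable_past
  (p a \o @past A) (fun x => (x (0 : int) == a)%:R).
apply => //; [|by move=> x; exact: p_ge0|].
  by apply: measurableT_comp => //; exact: measurable_past.
move=> B mB; have [_ _ _ pE] := p_version; rewrite /= pE//.
have mpB : measurable (@past A @^-1` B).
  by rewrite -[X in measurable X]setTI; exact: measurable_past.
have meq : measurable ([set x | x (0 : int) = a] : set (path_space int A)).
  exact: (@measurable_coordinate A _ (0 : int) [set a]).
rewrite (eq_integral
    (fun x => (\1_[set x : path_space int A | x (0 : int) = a] x)%:E)).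
  by rewrite integral_indic.
by move=> x _; rewrite -first_letter_indic.
Qed.

Lemma integral_step_nonneg g : (forall z, 0 <= g z) -> bounded_measurable g ->
  (\int[P]_x (step g (past x))%:E = \int[P]_x (g (past x))%:E)%E.
Proof.
move=> g_ge0 bg; have [mg _] := bg.
pose term k (x : path_space int A) : \bar R :=
  if is_code code decode k
  then (p (decode k) (past x) * g (cons_past (decode k) (past x)))%:E
  else 0%E.
transitivity (\int[P]_x \sum_(k <oo) term k x)%E.
  by apply: eq_integral => x _; rewrite step_series// eseries_mkcond.
rewrite (@integral_nneseries _ _ _ P _ _ term)//; last 2 first.
- move=> k; rewrite /term; case: (is_code code decode k) => //; apply/measurable_EFinP.
  apply: (measurableT_comp (measurable_summand k bg)); exact: measurable_past.
- by move=> k x _; rewrite /term; case: ifP => // _; rewrite lee_fin mulr_ge0.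
pose summand k (x : path_space int A) : \bar R :=
  if is_code code decode k
  then ((x (0 : int) == decode k)%:R * g (cons_past (decode k) (past x)))%:E
  else 0%E.
transitivity (\sum_(k <oo) \int[P]_x summand k x)%E.
  apply: eq_eseriesr => k _; rewrite /term /summand.
  case: (is_code code decode k) => //.
  apply: (@integral_conditional (decode k) (g \o cons_past (decode k))) => //;
    last by move=> z; exact: g_ge0.
  by apply: measurableT_comp => //; exact: measurable_cons_past.
transitivity (\int[P]_x \sum_(k <oo) summand k x)%E.
  apply/esym/integral_nneseries => //.
  - move=> k; rewrite /summand; case: (is_code code decode k) => //; apply/measurable_EFinP.
    apply: measurable_funM. exact: measurable_first_letter.
    apply: (measurableT_comp mg); apply: measurableT_comp.
      exact: measurable_cons_past.
    exact: measurable_past.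
  - by move=> k x _; rewrite /summand; case: ifP => // _; rewrite lee_fin mulr_ge0.
transitivity (\int[P]_x (g (past (Defs.shift x)))%:E)%E; last first.
  apply: (@integral_shift (g \o @past A)) => //; last by move=> x; exact: g_ge0.
  by apply: measurableT_comp => //; exact: measurable_past.
apply: eq_integral => x _; rewrite /summand -cons_past_shift -eseries_mkcond.
rewrite -(@esum_decode _ _ _ _ codeK
  (fun a => ((x (0 : int) == a)%:R * g (cons_past a (past x)))%:E)); last first.
  by move=> a; rewrite lee_fin mulr_ge0.
rewrite -(@esum_set1 _ _ (x (0 : int)) (fun a => (g (cons_past a (past x)))%:E)).
  rewrite [RHS]esum_mkcond; apply: eq_esum => a _.
  have -> : (a \in [set x (0 : int)]) = (x (0 : int) == a).
    by apply/idP/eqP => [/set_mem ->//|<-]; exact/mem_set.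
  by case: eqP => _; rewrite ?mul1r ?mul0r.
by rewrite lee_fin.
Qed.

(** The law of the past is invariant: given the past, the letter at time [0]
    has law [p], and the shifted process has the same law. *)
Lemma integral_step g : bounded_measurable g ->
  \int[P]_x step g (past x) = \int[P]_x g (past x).
Proof.
move=> bg; have [M [gM_ge0 bgM]] := bounded_measurable_lift bg.
have P1 : P setT = 1%E by exact: probability_setT.
have bpast h : bounded_measurable h -> bounded_measurable (h \o @past A : _ -> R).
  move=> [mh [N hN]]; split; last by exists N => x; exact: hN.
  by apply: measurableT_comp => //; exact: measurable_past.
have := integral_step_nonneg gM_ge0 bgM.
under eq_integral do rewrite step_lift//.
rewrite -!(EFin_mean P1); first last.
- apply: bounded_measurableD; last exact: bounded_measurable_cst.
  exact/bpast/bounded_measurable_step.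
- exact: (bpast _ bgM).
move=> [].
rewrite !(meanD P1) ?mean_cst//; do ?[exact: bounded_measurable_cst|exact: (bpast _ bg)|
  exact: (bpast _ (bounded_measurable_step bg))].
exact: addIr.
Qed.

End PastChain.

(** * Lipschitz functions of the past *)

Section Variation.
Context {R : realType} {A : pointedType}.
Variable p : A -> path_space nat A -> R.
Hypothesis p_ge0 : forall a z, 0 <= p a z.
Hypothesis p_sum1 : forall z, (\esum_(a in [set: A]) (p a z)%:E = 1)%E.

Let tv_le1 z z' :
  ((2^-1)%:E * (\esum_(a in [set: A]) `|p a z - p a z'|%:E) <= 1)%E.
Proof.
have : ((\esum_(a in [set: A]) `|p a z - p a z'|%:E) <= 2%:E)%E.
  apply: (@le_trans _ _ (\esum_(a in [set: A]) ((p a z)%:E + (p a z')%:E))%E).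
    apply: le_esum => a _; rewrite -EFinD lee_fin.
    by rewrite (le_trans (ler_normB _ _))// !ger0_norm.
  rewrite esumD; try (by move=> a _; rewrite lee_fin).
  by rewrite !p_sum1 -EFinD.
move=> /(lee_wpmul2l (_ : 0 <= (2^-1)%:E)%E); rewrite lee_fin => /(_ _)/le_trans.
by apply; rewrite ?invr_ge0// -EFinM mulVf.
Qed.

Let variation_fin n :
  (Defs.variation p n)%:E = ereal_sup [set r : \bar R | exists z z' : path_space nat A,
    (forall k, (k < n)%N -> z k = z' k) /\
    r = ((2^-1)%:E * \esum_(a in [set: A]) `|p a z - p a z'|%:E)%E].
Proof.
rewrite fineK// fin_real//; apply/andP; split.
  apply: (@lt_le_trans _ _ 0%E) => //; apply: ereal_sup_ubound.
  exists point, point; split=> //.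
  rewrite (eq_esum (b := fun=> 0%E)) ?esum1 ?mule0// => a _.
  by rewrite subrr normr0.
apply: (@le_lt_trans _ _ 1%E); last by rewrite ltry.
by apply: ge_ereal_sup => _ [z [z' [_ ->]]]; exact: tv_le1.
Qed.

(** The supremum defining the variation is finite, the total variation
    distance of two probabilities being at most [1]. *)
Lemma tv_le_variation n z z' : (forall k, (k < n)%N -> z k = z' k) ->
  ((2^-1)%:E * (\esum_(a in [set: A]) `|p a z - p a z'|%:E)
     <= (Defs.variation p n)%:E)%E.
Proof.
by move=> zz'; rewrite variation_fin; apply: ereal_sup_ubound; exists z, z'.
Qed.

Lemma variation_ge0 n : 0 <= Defs.variation p n.
Proof.
rewrite -lee_fin; apply: le_trans (@tv_le_variation n point point _) => //.
by rewrite mule_ge0 ?lee_fin ?invr_ge0//; apply: esum_ge0 => a _; rewrite lee_fin.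
Qed.

Lemma variation_le1 n : Defs.variation p n <= 1.
Proof.
rewrite -lee_fin variation_fin.
by apply: ge_ereal_sup => _ [z [z' [_ ->]]]; exact: tv_le1.
Qed.

Lemma Gamma_coef_le_prod n :
  Gamma_coef p <= \prod_(0 <= j < n) (1 - Defs.variation p j).
Proof.
pose u n := \prod_(0 <= j < n) (1 - Defs.variation p j).
have u_ge0 k : 0 <= u k.
  by apply: prodr_ge0 => j _; rewrite subr_ge0 variation_le1.
have u_nincr : nonincreasing_seq u.
  apply/nonincreasing_seqP => k; rewrite /u big_nat_recr//= ler_piMr//.
    exact: u_ge0.
  by rewrite gerBl variation_ge0.
apply: (nonincreasing_cvgn_ge u_nincr).
by apply: nonincreasing_is_cvgn => //; exists 0 => _ [k _ <-]; exact: u_ge0.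
Qed.

End Variation.

Section LipschitzPast.
Context {R : realType} {A : pointedType}.
Variables (code : A -> nat) (decode : nat -> A).
Hypothesis codeK : cancel code decode.
Variable P : probability (path_space int A) R.
Hypothesis P_stationary : stationary P.
Variable p : A -> path_space nat A -> R.
Hypothesis p_version : left_conditional_version P p.
Variable gamma : R.
Hypothesis gamma_gt0 : 0 < gamma.
Hypothesis gamma_le : gamma <= Gamma_coef p.
Variable L : R.
Hypothesis L_gt0 : 0 < L.
Implicit Types g : path_space nat A -> R.

Local Notation step := (step code decode p).

Let p_ge0 a z : 0 <= p a z. Proof. by have [] := p_version. Qed.
Let p_sum1 z : (\esum_(a in [set: A]) (p a z)%:E = 1)%E.
Proof. by have [] := p_version. Qed.
Let P1 : P setT = 1%E. Proof. exact: probability_setT. Qed.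

Definition agreement_prob n := \prod_(0 <= j < n) (1 - Defs.variation p j).

Let agreement_ge n : gamma <= agreement_prob n.
Proof. exact: le_trans gamma_le (Gamma_coef_le_prod p_ge0 p_sum1 n). Qed.

Let agreement_gt0 n : 0 < agreement_prob n.
Proof. exact: lt_le_trans (agreement_ge n). Qed.

Definition mismatches n (z z' : path_space nat A) : R :=
  \sum_(i < n) (z i != z' i)%:R.

(** Modulus of continuity for functions of the last [n] letters after averaging
    over the future: [mismatches] counts the visible disagreements, and
    [1 / gamma - 1 / agreement_prob j] bounds the expected number of future
    disagreements of two pasts that agree on their last [j] letters. *)
Definition lipschitz_past n g := forall z z' j,
  (forall k, (k < j)%N -> z k = z' k) ->
  g z - g z' <= L * (mismatches n z z' + gamma^-1 - (agreement_prob j)^-1).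

Let mismatches_cons n a b z z' :
  mismatches n.+1 (cons_past a z) (cons_past b z') =
  (a != b)%:R + mismatches n z z'.
Proof. by rewrite /mismatches big_ord_recl. Qed.

Let lipschitz_cons n g a b z z' : lipschitz_past n.+1 g ->
  g (cons_past a z) - g (cons_past b z') <= L * (mismatches n z z' + gamma^-1).
Proof.
move=> /(_ (cons_past a z) (cons_past b z') 0%N)/(_ (fun _ => ltac:(done))).
move=> /le_trans; apply; rewrite ler_pM2l// mismatches_cons.
by rewrite /agreement_prob big_nil invr1; case: (_ != _) => /=; lra.
Qed.

(** One step of a maximal coupling.  With probability at least [1 - Var_j] the
    same letter is appended to both pasts and the bound [u] applies; otherwise
    different letters may be appended and the worse bound [w] applies.  The
    modulus is the solution of the recursion [(1 - Var_j) u + Var_j w]. *)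
Lemma lipschitz_past_step n g : bounded_measurable g ->
  lipschitz_past n.+1 g -> lipschitz_past n (step g).
Proof.
move=> bg lip_g z z' j zz'.
pose u := L * (mismatches n z z' + gamma^-1 - (agreement_prob j.+1)^-1).
pose w := L * (mismatches n z z' + gamma^-1).
have uw : u <= w by rewrite ler_pM2l// gerBl invr_ge0 ltW.
have same a : g (cons_past a z) <= g (cons_past a z') + u.
  rewrite -lerBlDl; apply: le_trans (lip_g _ _ j.+1 _) _.
    by move=> -[|k] //=; rewrite ltnS; exact: zz'.
  by rewrite mismatches_cons eqxx add0r.
have [_ [M gM]] := bg.
pose lo := inf (range (fun b => g (cons_past b z'))).
have lo_lb : has_lbound (range (fun b => g (cons_past b z'))).
  by exists (- M) => _ [b _ <-]; have := gM (cons_past b z'); rewrite ler_norml => /andP[].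
have lo_le a : lo <= g (cons_past a z') by apply: ge_inf => //; exists a.
have other a : g (cons_past a z) <= lo + w.
  rewrite -lerBlDr; apply: lb_le_inf.
    by exists (g (cons_past point z')), point.
  by move=> _ [b _ <-]; have := lipschitz_cons a b z z' lip_g; rewrite -/w; lra.
(* A function between the two continuations which oscillates by [w - u] only:
   this replaces an explicit coupling of the two laws of the next letter. *)
pose chi a := Num.min (g (cons_past a z') + u) (lo + w).
have chi_bd a : lo + u <= chi a <= lo + w.
  by rewrite le_min lerD2r lo_le lerD2l uw /= ge_min lexx orbT.
have bchi : bounded_measurable (chi : letter_space A -> R).
  split; first exact: measurable_fun_letters.
  exists (`|lo + u| + `|lo + w|) => a; rewrite ler_norml.
  have /andP[] := chi_bd a.
  have := ler_norm (lo + w); have := ler_norm (- (lo + u)); rewrite normrN.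
  have := normr_ge0 (lo + w); have := normr_ge0 (lo + u).
  by move=> *; apply/andP; split; lra.
have law1 y := next_law_setT codeK p_version y.
have tv := letter_law_mean_le codeK (p_ge0 ^~ z) (p_sum1 z) (p_ge0 ^~ z')
  (p_sum1 z') (tv_le_variation p_ge0 p_sum1 zz') chi_bd.
have step_le : step g z <= \int[letter_law code decode (p^~ z)]_a chi a.
  apply: (mean_le (law1 z)) => //; first exact: bounded_cons_past.
  by move=> a; rewrite le_min same other.
have chi_le : \int[letter_law code decode (p^~ z')]_a chi a <= step g z' + u.
  rewrite -[X in _ + X](mean_cst (law1 z')) -(meanD (law1 z')).
  - apply: (mean_le (law1 z')) => //.
      apply: bounded_measurableD; first exact: bounded_cons_past.
      exact: bounded_measurable_cst.
    by move=> a; rewrite ge_min lexx.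
  - exact: bounded_cons_past.
  - exact: bounded_measurable_cst.
rewrite lerBlDl; apply: (le_trans step_le); apply: (le_trans tv).
apply: (@le_trans _ _ (step g z' + u + Defs.variation p j * (lo + w - (lo + u)))).
  by rewrite lerD2r.
rewrite -addrA lerD2l le_eqVlt; apply/orP; left; apply/eqP.
have := agreement_gt0 j.+1; have := agreement_gt0 j.
rewrite /u /w /agreement_prob big_nat_recr//= -/(agreement_prob j) => j_gt0 Sj_gt0.
have j1_gt0 : 0 < 1 - Defs.variation p j by move: Sj_gt0; rewrite pmulr_rgt0.
by field; rewrite !gt_eqF.
Qed.

Let c := L / gamma.
Let c_gt0 : 0 < c. Proof. exact: divr_gt0. Qed.

(** Revealing one letter costs at most [c], by comparison of two pasts that
   differ in their last letter only. *)
Let step_osc n g : lipschitz_past n.+1 g ->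
  forall z a b, g (cons_past a z) - g (cons_past b z) <= c.
Proof.
move=> lip_g z a b; apply: le_trans (lipschitz_cons a b z z lip_g) _.
by rewrite /mismatches big1 ?add0r// => i _; rewrite eqxx.
Qed.

Let lipschitz0_osc g : lipschitz_past 0 g -> forall z z', g z - g z' <= c.
Proof.
move=> lip_g z z'; apply: le_trans (lip_g z z' 0%N _) _ => //.
rewrite ler_pM2l// /mismatches big_ord0 add0r gerBl invr_ge0.
by rewrite /agreement_prob big_nil.
Qed.

Let bounded_past g : bounded_measurable g ->
  bounded_measurable (fun x : path_space int A => g (past x)).
Proof.
move=> [mg [M gM]]; split; last by exists M => x; exact: gM.
by apply: measurableT_comp => //; exact: measurable_past.
Qed.

(** Induction on the number of letters on which [g] depends.  When none is left,
    the conditional expectation still varies with the infinite past, but by at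
    most [c]; this accounts for [n.+1] instead of [n]. *)
Lemma mgf_past_le n g s : bounded_measurable g -> lipschitz_past n g ->
  \int[P]_x expR (s * g (past x)) <=
  expR (s * \int[P]_x g (past x) + n.+1%:R * (s ^+ 2 * c ^+ 2 / 4)).
Proof.
elim: n g => [|n IHn] g bg lip_g.
  rewrite mul1r; apply: (mgf_le_osc P1) => //; first exact: bounded_past.
  by move=> x y; exact: (lipschitz0_osc lip_g).
have bexp := bounded_measurable_expR s bg.
have bstep := bounded_measurable_step codeK p_version bg.
pose k := s ^+ 2 * c ^+ 2 / 4.
rewrite -(integral_step codeK P_stationary p_version bexp).
apply: (@le_trans _ _ (\int[P]_x (expR k * expR (s * step g (past x))))).
  apply: (mean_le P1).
  - exact/bounded_past/(bounded_measurable_step codeK p_version).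
  - exact/bounded_measurableZ/(bounded_past (bounded_measurable_expR s bstep)).
  - move=> x; rewrite -expRD addrC.
    apply: (mgf_le_osc (next_law_setT codeK p_version (past x))) => //.
      exact: bounded_cons_past.
    by move=> a b; exact: (step_osc lip_g).
rewrite (meanZ P1); last exact: (bounded_past (bounded_measurable_expR s bstep)).
have := IHn _ bstep (lipschitz_past_step bg lip_g).
move=> /(ler_wpM2l (expR_ge0 k)) /le_trans; apply.
rewrite -expRD ler_expR (integral_step codeK P_stationary p_version bg).
by rewrite -/k -[in leRHS](natr1 n.+1); lra.
Qed.

Lemma second_moment_past_le n g r : bounded_measurable g -> lipschitz_past n g ->
  \int[P]_x (g (past x) - r) ^+ 2 <=
  (\int[P]_x g (past x) - r) ^+ 2 + n.+1%:R * c ^+ 2.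
Proof.
elim: n g => [|n IHn] g bg lip_g.
  rewrite mul1r; apply: (second_moment_le_osc P1) => //; first exact: bounded_past.
  by move=> x y; exact: (lipschitz0_osc lip_g).
have bcenter h : bounded_measurable h ->
    bounded_measurable (fun z : path_space nat A => (h z - r) ^+ 2).
  move=> bh; apply/bounded_measurableX/bounded_measurableD => //.
  exact: bounded_measurable_cst.
have bstep := bounded_measurable_step codeK p_version bg.
rewrite -(integral_step codeK P_stationary p_version (bcenter _ bg)).
apply: (@le_trans _ _ (\int[P]_x ((step g (past x) - r) ^+ 2 + c ^+ 2))).
  apply: (mean_le P1).
  - exact/bounded_past/(bounded_measurable_step codeK p_version)/bcenter.
  - apply: bounded_measurableD; last exact: bounded_measurable_cst.
    exact: (bounded_past (bcenter _ bstep)).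
  - move=> x; apply: (second_moment_le_osc (next_law_setT codeK p_version (past x))) => //.
      exact: bounded_cons_past.
    by move=> a b; exact: (step_osc lip_g).
rewrite (meanD P1) ?(mean_cst P1); first last.
- exact: bounded_measurable_cst.
- exact: (bounded_past (bcenter _ bstep)).
have := IHn _ bstep (lipschitz_past_step bg lip_g).
rewrite (integral_step codeK P_stationary p_version bg) => IH.
by rewrite -(natr1 n.+1); lra.
Qed.

End LipschitzPast.

(** * From the past to the sample *)

Section FiniteCoordinates.
Context {A : pointedType}.
Hypothesis A_countable : countable [set: A].

Lemma countable_ffun (J : finType) : countable [set: {ffun J -> A}].
Proof.
have [code [decode codeK]] := countable_decode (point : A) A_countable.
apply/countable_injP.
exists (fun w : {ffun J -> A} => choice.pickle [ffun j => code (w j)]).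
move=> w w' _ _ /(pcan_inj (@choice.pickleK _)) /ffunP ww'.
by apply/ffunP => j; apply: (can_inj codeK); have := ww' j; rewrite !ffunE.
Qed.

(** A union of countably many cylinders. *)
Lemma measurable_finite_coords (I : Type) (J : finType) (c : J -> I)
    (S : set (path_space I A)) :
  (forall x y, (forall j, x (c j) = y (c j)) -> S x -> S y) -> measurable S.
Proof.
move=> S_dep; pose res (x : I -> A) : {ffun J -> A} := [ffun j => x (c j)].
rewrite (_ : S = \bigcup_(b in [set: {ffun J -> A}])
    if `[< exists2 x, S x & res x = b >]
    then \bigcap_(j in [set: J]) [set x | [set b j] (x (c j))] else set0).
  apply: countable_bigcupT_measurable; first exact: countable_ffun.
  move=> b; case: ifP => // _; apply: fin_bigcap_measurable => //.
  by move=> j _; exact: measurable_coordinate.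
apply/seteqP; split => x.
  move=> Sx; exists (res x) => //; rewrite asboolT; last by exists x.
  by move=> j _; rewrite /= ffunE.
move=> [b _]; case: asboolP => // -[y Sy <-] xy; apply: S_dep Sy => j.
by have := xy j Logic.I; rewrite /= ffunE.
Qed.

Lemma measurable_fun_finite_coords d (T : measurableType d) (I : Type)
    (J : finType) (c : J -> I) (F : path_space I A -> T) :
  (forall x y, (forall j, x (c j) = y (c j)) -> F x = F y) ->
  measurable_fun [set: path_space I A] F.
Proof.
move=> F_dep _ B _; rewrite setTI; apply: (@measurable_finite_coords _ _ c).
by move=> x y xy; rewrite /preimage /= (F_dep _ _ xy).
Qed.

End FiniteCoordinates.

Section Sample.
Context {R : realType} {A : pointedType}.
Hypothesis A_countable : countable [set: A].
Variable P : probability (path_space int A) R.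
Hypothesis P_stationary : stationary P.
Implicit Types (x y : int -> A) (F : path_space int A -> R).

Let P1 : P setT = 1%E. Proof. exact: probability_setT. Qed.

Definition sample_dependent (S : Type) n (F : path_space int A -> S) :=
  forall x y : path_space int A,
    (forall t, (t < n)%N -> x t.+1%:Z = y t.+1%:Z) -> F x = F y.

(** Reads a past as a path on [1..n]: the most recent letter is at time [n]. *)
Definition unpast n (z : path_space nat A) : path_space int A :=
  fun i => z `|n%:Z - i|%N.

Lemma iter_shiftE m x i : iter m (@Defs.shift A) x i = x (i + m%:Z).
Proof.
elim: m x i => [|m IHm] x i; first by rewrite addr0.
by rewrite iterSr IHm /Defs.shift -addrA intS [1 + _]addrC.
Qed.

Lemma measurable_iter_shift m :
  measurable_fun [set: path_space int A] (iter m (@Defs.shift A) : _ -> path_space int A).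
Proof.
apply: measurable_fun_path => i B.
rewrite (_ : [set _ | _] = [set x | B (x (i + m%:Z))]).
  exact: measurable_coordinate.
by apply/funext => x /=; rewrite iter_shiftE.
Qed.

Lemma unpast_past n x t : (t < n)%N ->
  unpast n (past (iter n.+1 (@Defs.shift A) x)) t.+1%:Z = x t.+1%:Z.
Proof.
move=> tn; rewrite /unpast /past iter_shiftE; congr x.
by rewrite NegzE; lia.
Qed.

Lemma sample_dependent_measurable n F : sample_dependent n F ->
  measurable_fun setT F.
Proof.
move=> Fn.
apply: (@measurable_fun_finite_coords _ A_countable _ _ _ _ (fun t : 'I_n => t.+1%:Z)).
by move=> x y xy; apply: Fn => t tn; exact: (xy (Ordinal tn)).
Qed.

Lemma sample_dependent_unpast_measurable n F : sample_dependent n F ->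
  measurable_fun setT (F \o unpast n).
Proof.
move=> Fn; apply: (@measurable_fun_finite_coords _ A_countable _ _ _ _
  (fun t : 'I_n => nat_of_ord t)).
move=> z z' zz' /=; apply: Fn => t tn; rewrite /unpast.
have tn' : (n - t.+1 < n)%N by lia.
rewrite (_ : `|_|%N = Ordinal tn'); first exact: zz'.
by rewrite /=; lia.
Qed.

Lemma mean_iter_shift m F : bounded_measurable F ->
  \int[P]_x F (iter m (@Defs.shift A) x) = \int[P]_x F x.
Proof.
elim: m F => [//|m IHm] F bF; have [mF [M FM]] := bF.
have bFs : bounded_measurable (fun x : path_space int A => F (Defs.shift x)).
  split; last by exists M => x; exact: FM.
  exact: (measurableT_comp mF (@measurable_shift A)).
have FsE : \int[P]_x F (Defs.shift x) = \int[P]_x F x.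
  have cstM : bounded_measurable (fun _ : path_space int A => M).
    exact: bounded_measurable_cst.
  have mFM : measurable_fun setT (fun x : path_space int A => F x + M) by exact: measurable_funD.
  have FM_ge0 (x : path_space int A) : 0 <= F x + M.
    by have := FM x; rewrite ler_norml -subr_ge0 opprK => /andP[].
  have := integral_shift P_stationary mFM FM_ge0.
  move=> /(congr1 fine); rewrite -!/(Rintegral _ _ _).
  by rewrite !(meanD P1)// => /addIr.
by rewrite -FsE -(IHm _ bFs).
Qed.

(** By stationarity the sample [X_1..X_n] has the law of the last [n] letters of
    the past. *)
Lemma mean_unpast n F : sample_dependent n F -> (exists M, forall x, `|F x| <= M) ->
  \int[P]_x F (unpast n (past x)) = \int[P]_x F x.
Proof.
move=> Fn [M FM].
rewrite -(@mean_iter_shift n.+1 (fun x => F (unpast n (past x)))).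
  apply: eq_Rintegral => x _; apply: Fn => t tn.
  exact: unpast_past.
split; last by exists M => x; exact: FM.
apply: (measurableT_comp (sample_dependent_unpast_measurable Fn)).
exact: measurable_past.
Qed.

Definition hamming n x y : R :=
  \sum_(0 <= t < n) (x t.+1%:Z != y t.+1%:Z)%:R.

Definition lipschitz_sample n L F :=
  forall x y : path_space int A, F x - F y <= L * hamming n x y.

Lemma lipschitz_sample_dependent n L F :
  lipschitz_sample n L F -> sample_dependent n F.
Proof.
move=> lipF x y xy.
have hxy : hamming n x y = 0.
  by rewrite /hamming big_nat big1// => t /andP[_ tn]; rewrite xy ?eqxx.
have hyx : hamming n y x = 0.
  by rewrite /hamming big_nat big1// => t /andP[_ tn]; rewrite xy ?eqxx.
apply/eqP; rewrite eq_le -subr_le0 -[X in _ && X]subr_le0.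
have := lipF x y; have := lipF y x; rewrite hxy hyx mulr0 => -> ->.
by [].
Qed.

Variable p : A -> path_space nat A -> R.
Hypothesis p_version : left_conditional_version P p.
Variable gamma : R.
Hypothesis gamma_gt0 : 0 < gamma.
Hypothesis gamma_le : gamma <= Gamma_coef p.
Variable L : R.
Hypothesis L_gt0 : 0 < L.

Lemma hamming_unpast n z z' :
  hamming n (unpast n z) (unpast n z') = mismatches (R := R) n z z'.
Proof.
rewrite /hamming /mismatches big_mkord (reindex_inj rev_ord_inj) /=.
apply: eq_bigr => t _; rewrite /unpast.
by rewrite (_ : `|_|%N = t)//; have := ltn_ord t; lia.
Qed.

(** The additional term of the modulus of [lipschitz_past] is nonnegative. *)
Lemma lipschitz_sample_past n F : lipschitz_sample n L F ->
  lipschitz_past p gamma L n (F \o unpast n).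
Proof.
have [p_ge0 p_sum1 _ _] := p_version.
move=> lipF z z' j _ /=; apply: le_trans (lipF _ _) _.
rewrite hamming_unpast ler_pM2l// -addrA lerDl subr_ge0.
have g_le := le_trans gamma_le (Gamma_coef_le_prod p_ge0 p_sum1 j).
by rewrite lef_pV2// posrE ?(lt_le_trans gamma_gt0).
Qed.

Lemma mgf_sample_le n F s : lipschitz_sample n L F ->
  (exists M, forall x, `|F x| <= M) ->
  \int[P]_x expR (s * F x) <=
  expR (s * \int[P]_x F x + n.+1%:R * (s ^+ 2 * (L / gamma) ^+ 2 / 4)).
Proof.
move=> lipF [M FM]; have [code [decode codeK]] := countable_decode (point : A) A_countable.
have Fn := lipschitz_sample_dependent lipF.
have bF : bounded_measurable (F \o unpast n).
  by split; [exact: sample_dependent_unpast_measurable|exists M => x; exact: FM].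
rewrite -(mean_unpast Fn); last by exists M.
have expn : sample_dependent n (fun x => expR (s * F x)).
  by move=> x y xy; rewrite (Fn _ _ xy).
rewrite -(mean_unpast expn); last first.
  exists (expR (`|s| * M)) => x; rewrite ger0_norm ?expR_ge0// ler_expR.
  by rewrite (le_trans (ler_norm _))// normrM ler_wpM2l.
exact: (mgf_past_le codeK P_stationary p_version gamma_gt0 gamma_le L_gt0 s bF
  (lipschitz_sample_past lipF)).
Qed.

Lemma variance_sample_le n F : lipschitz_sample n L F ->
  (exists M, forall x, `|F x| <= M) ->
  \int[P]_x (F x - \int[P]_x F x) ^+ 2 <= n.+1%:R * (L / gamma) ^+ 2.
Proof.
move=> lipF [M FM]; have [code [decode codeK]] := countable_decode (point : A) A_countable.
have Fn := lipschitz_sample_dependent lipF.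
have bF : bounded_measurable (F \o unpast n).
  by split; [exact: sample_dependent_unpast_measurable|exists M => x; exact: FM].
set m := \int[P]_x F x.
have mE : \int[P]_x F (unpast n (past x)) = m by apply: mean_unpast => //; exists M.
have sqn : sample_dependent n (fun x => (F x - m) ^+ 2).
  by move=> x y xy; rewrite (Fn _ _ xy).
rewrite -(mean_unpast sqn); last first.
  exists ((M + `|m|) ^+ 2) => x; rewrite normrX lerXn2r ?nnegrE//.
    by rewrite addr_ge0// (le_trans _ (FM x)).
  by rewrite (le_trans (ler_normB _ _))// lerD2r.
have := second_moment_past_le codeK P_stationary p_version gamma_gt0 gamma_le
  L_gt0 m bF (lipschitz_sample_past lipF).
by rewrite /= mE subrr expr0n add0r.
Qed.

End Sample.

(** * Counting occurrences *)

Section Tally.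
Context {R : realType} {A : pointedType}.
Variables (D G : {fset int}).
Hypothesis min_le : forall j : int, j \in (G `|` D)%fset -> 1 <= j.
Implicit Types (x y : int -> A) (b : {ffun D -> A}) (phi : {ffun G -> A} -> R).

Lemma card_windows_gt0 : 1 \in (G `|` D)%fset -> (0 < #|` G| + #|` D|)%N.
Proof.
rewrite addn_gt0 !cardfs_gt0 inE.
by move=> /orP[] j1; apply/orP; [left|right]; apply/fset0Pn; exists 1.
Qed.

Definition fits n (i : int) := in_sample D n i && in_sample G n i.

(** The weights [phi] make it possible to treat counts, differences of counts
    and signed sums of counts alike. *)
Definition tally n b phi x : R :=
  \sum_(0 <= i < n) (fits n i && (shifted_pattern D i x == b))%:R *
    phi (shifted_pattern G i x).

Lemma occurrencesE n x b (a : {ffun G -> A}) :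
  (occurrences n x b a)%:R = tally n b (fun u => (u == a)%:R) x.
Proof.
rewrite /occurrences natr_sum; apply: eq_bigr => i _.
by rewrite -natrM mulnb /fits -!andbA.
Qed.

Lemma sum_shift_le (F : nat -> R) k n : (forall t, 0 <= F t) ->
  \sum_(0 <= i < n) (i + k < n)%:R * F (i + k)%N <= \sum_(0 <= t < n) F t.
Proof.
move=> F_ge0.
have -> : \sum_(0 <= t < n) F t = \sum_(0 <= t < n + k) (t < n)%:R * F t.
  rewrite (big_cat_nat (leq0n _) (leq_addr k n))//= [X in _ + X]big_nat [X in _ + X]big1 ?addr0.
    by apply: eq_big_nat => t /andP[_ ->]; rewrite mul1r.
  by move=> t /andP[nt _]; rewrite ltnNge nt mul0r.
rewrite (big_cat_nat (leq0n _) (leq_addl n k))//=.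
rewrite -{4}[k]add0n [X in _ <= _ + X]big_addn addnK.
by rewrite lerDr sumr_ge0// => t _; rewrite mulr_ge0.
Qed.

Definition differ_at (H : {fset int}) (i : int) x y : R :=
  \sum_(j : H) (x (i + val j) != y (i + val j))%:R.

Lemma differ_at_ge1 (H : {fset int}) i x y :
  shifted_pattern H i x != shifted_pattern H i y -> 1 <= differ_at H i x y.
Proof.
move=> ne; have [j jne] : exists j : H, x (i + val j) != y (i + val j).
  apply/existsP; rewrite -negb_forall; apply: contra ne => /forallP eq_xy.
  by apply/eqP/ffunP => j; rewrite !ffunE; exact/eqP/eq_xy.
by rewrite /differ_at (bigD1 j)//= jne lerDl sumr_ge0.
Qed.

(** For a fixed [j] in [H], distinct positions [i] look at distinct letters
    [i + j] of the sample. *)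
Lemma sum_differ_at_le (H : {fset int}) n x y :
  (forall j, j \in H -> 1 <= j) ->
  (forall i, fits n i -> in_sample H n i) ->
  \sum_(0 <= i < n) (fits n (Posz i))%:R * differ_at H i x y <=
  #|` H|%:R * hamming (R := R) n x y.
Proof.
move=> H_ge1 fitsH.
under eq_bigr do rewrite /differ_at mulr_sumr.
rewrite exchange_big /= cardfE mulr_natl -sumr_const.
apply: ler_sum => j _.
pose F t : R := (x t.+1%:Z != y t.+1%:Z)%:R.
apply: le_trans (sum_shift_le (`|val j|.-1) n (F := F) _); last by move=> t.
have j1 := H_ge1 _ (valP j).
apply: ler_sum => i _; case: (boolP (fits n i)) => [fi|_]; last first.
  by rewrite mul0r mulr_ge0.
rewrite mul1r.
have /forallP/(_ j)/andP[_ ij] := fitsH _ fi.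
have -> : i%:Z + val j = (i + `|val j|.-1).+1%:Z by lia.
have -> : (i + `|val j|.-1 < n)%N by lia.
by rewrite mul1r.
Qed.

(** Changing one letter affects at most [|G| + |D|] positions, and each position
    contributes a number in [[-1, 1]]. *)
Lemma tally_lipschitz n b phi : (forall u, `|phi u| <= 1) ->
  lipschitz_sample n (2 * (#|` G| + #|` D|)%:R) (tally n b phi).
Proof.
move=> phi_le1 x y; rewrite /tally -sumrB natrD mulrDr mulrDl -!mulrA.
have memG j : j \in G -> 1 <= j by move=> jG; apply: min_le; rewrite inE jG.
have memD j : j \in D -> 1 <= j by move=> jD; apply: min_le; rewrite inE jD orbT.
have leG : \sum_(0 <= i < n) (fits n (Posz i))%:R * differ_at G i x y <=
    #|` G|%:R * hamming n x y.
  by apply: sum_differ_at_le => // i /andP[].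
have leD : \sum_(0 <= i < n) (fits n (Posz i))%:R * differ_at D i x y <=
    #|` D|%:R * hamming n x y.
  by apply: sum_differ_at_le => // i /andP[].
rewrite -mulrDr.
apply: le_trans (ler_wpM2l _ (lerD leG leD)) => //.
rewrite -big_split mulr_sumr /=; apply: ler_sum => i _.
have dG : 0 <= differ_at G i x y by exact: sumr_ge0.
have dD : 0 <= differ_at D i x y by exact: sumr_ge0.
case: (fits n i) => /=; last by rewrite !mul0r addr0 mulr0 subrr.
rewrite !mul1r.
have phix := phi_le1 (shifted_pattern G i x).
have phiy := phi_le1 (shifted_pattern G i y).
move: phix phiy; rewrite !ler_norml => /andP[x1 x2] /andP[y1 y2].
have [Deq|Dne] := eqVneq (shifted_pattern D i x) (shifted_pattern D i y).
  have [Geq|Gne] := eqVneq (shifted_pattern G i x) (shifted_pattern G i y).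
    by rewrite Deq Geq subrr mulr_ge0// addr_ge0.
  have := differ_at_ge1 Gne.
  by case: (_ == b); case: (_ == b); rewrite ?mul1r ?mul0r; lra.
have := differ_at_ge1 Dne.
by case: (_ == b); case: (_ == b); rewrite ?mul1r ?mul0r; lra.
Qed.

Lemma tally_bounded n b phi x : (forall u, `|phi u| <= 1) ->
  `|tally n b phi x| <= n%:R.
Proof.
move=> phi_le1; apply: le_trans (ler_norm_sum _ _ _) _.
rewrite -[n in leRHS]subn0 -[leRHS]mul1r mulr_natr -sumr_const_nat.
apply: ler_sum => i _; rewrite normrM normr_nat.
by case: (_ && _); rewrite ?mul1r ?mul0r.
Qed.

Definition fit_count n : R := \sum_(0 <= i < n) (fits n (Posz i))%:R.

Lemma fit_count_le n : fit_count n <= n%:R.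
Proof.
rewrite -[n in leRHS]subn0 -[leRHS]mul1r mulr_natr -sumr_const_nat.
by apply: ler_sum => i _; rewrite lern1 leq_b1.
Qed.

Lemma fit_count_ge : exists M : nat, forall n, n%:R - M%:R <= fit_count n.
Proof.
pose M := (\sum_(j : G) `|val j| + \sum_(j : D) `|val j|)%N.
have fitsM n i : (i + M <= n)%N -> fits n i.
  move=> iM; apply/andP; split; apply/forallP => j.
    have jM : (`|val j| <= M)%N.
      by rewrite /M (bigD1 j)//= addnC -addnA leq_addr.
    have : 1 <= val j by apply: min_le; rewrite inE (valP j) orbT.
    by rewrite /= in jM *; move=> j1; apply/andP; split; lia.
  have jM : (`|val j| <= M)%N by rewrite /M (bigD1 j)//= -addnA leq_addr.
  have : 1 <= val j by apply: min_le; rewrite inE (valP j).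
  by rewrite /= in jM *; move=> j1; apply/andP; split; lia.
exists M => n; have [Mn|nM] := leqP M n; last first.
  apply: (@le_trans _ _ 0); last exact: sumr_ge0.
  by rewrite subr_le0 ler_nat ltnW.
rewrite /fit_count (big_cat_nat (leq0n _) (leq_subr M n))//= -natrB//.
rewrite -[leLHS]addr0 lerD ?sumr_ge0//.
rewrite -[(n - M)%N in leLHS]subn0 -[leLHS]mul1r mulr_natr -sumr_const_nat.
rewrite [leLHS]big_nat [leRHS]big_nat; apply: ler_sum => i /andP[_ iM].
by rewrite fitsM//; lia.
Qed.

Hypothesis A_countable : countable [set: A].
Variable P : probability (path_space int A) R.
Hypothesis P_stationary : stationary P.

Lemma measurable_patterns (S : {ffun D -> A} -> {ffun G -> A} -> Prop) :
  measurable [set x : path_space int A | S (pattern D x) (pattern G x)].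
Proof.
apply: (@measurable_finite_coords _ A_countable _ _
  (fun j : G + D => match j with inl j => val j | inr j => val j end)).
move=> x y xy /=; rewrite (_ : pattern G y = pattern G x); last first.
  by apply/ffunP => j; rewrite !ffunE (xy (inl j)).
rewrite (_ : pattern D y = pattern D x)//.
by apply/ffunP => j; rewrite !ffunE (xy (inr j)).
Qed.

Lemma measurable_joint b (a : {ffun G -> A}) :
  measurable [set x : path_space int A | pattern G x = a /\ pattern D x = b].
Proof. exact: (measurable_patterns (fun d g => g = a /\ d = b)). Qed.

Lemma shifted_patternE (H : {fset int}) (i : nat) x :
  shifted_pattern H i x = pattern H (iter i (@Defs.shift A) x).
Proof. by apply/ffunP => j; rewrite !ffunE iter_shiftE addrC. Qed.

Lemma mean_tally n b (a : {ffun G -> A}) :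
  \int[P]_x tally n b (fun u => (u == a)%:R) x =
  fit_count n * joint P b a.
Proof.
have P1 : P setT = 1%E by exact: probability_setT.
have mJ := measurable_joint b a.
set E := [set x : path_space int A | _] in mJ.
have bE : bounded_measurable (\1_E : path_space int A -> R).
  split; first exact: measurable_indic.
  by exists 1 => x; rewrite indicE; case: (_ \in _); rewrite ?normr1 ?normr0.
have termE i (x : path_space int A) :
    (fits n (Posz i) && (shifted_pattern D i x == b))%:R *
      (shifted_pattern G i x == a)%:R =
    (fits n (Posz i))%:R * (\1_E (iter i (@Defs.shift A) x) : R).
  rewrite -mulnb natrM -mulrA; congr (_ * _).
  rewrite -natrM mulnb !shifted_patternE indicE; congr (_%:R); congr nat_of_bool.
  apply/andP/idP => [[/eqP Dx /eqP Gx]|/set_mem[-> ->]//].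
  by apply/mem_set; split.
have biter i : bounded_measurable
    (fun x : path_space int A => \1_E (iter i (@Defs.shift A) x) : R).
  split; last by exists 1 => x; rewrite indicE; case: (_ \in _); rewrite ?normr1 ?normr0.
  exact: (measurableT_comp bE.1 (@measurable_iter_shift A i)).
rewrite (_ : (\int[P]_x _) = \int[P]_x (\sum_(0 <= i < n)
    (fits n (Posz i))%:R * \1_E (iter i (@Defs.shift A) x))); last first.
  by apply: eq_Rintegral => x _; apply: eq_bigr => i _; exact: termE.
rewrite (mean_sum P1); last by move=> i; exact/bounded_measurableZ/biter.
rewrite /fit_count mulr_suml; apply: eq_bigr => i _.
rewrite (meanZ P1)//; congr (_ * _).
rewrite (mean_iter_shift P_stationary i bE) /Rintegral integral_indic//.
by rewrite setIT.
Qed.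

End Tally.

(** * The spread of the counts *)

Section Spread.
Context {R : realType} {A : pointedType}.
Hypothesis A_countable : countable [set: A].
Variables (D G : {fset int}).
Hypothesis min_in : 1 \in (G `|` D)%fset.
Hypothesis min_le : forall j : int, j \in (G `|` D)%fset -> 1 <= j.
Variable P : probability (path_space int A) R.
Hypothesis P_stationary : stationary P.
Variable p : A -> path_space nat A -> R.
Hypothesis p_version : left_conditional_version P p.
Variable gamma : R.
Hypothesis gamma_gt0 : 0 < gamma.
Hypothesis gamma_le : gamma <= Gamma_coef p.
Variables (n : nat) (b : {ffun D -> A}).
Implicit Types (a : {ffun G -> A}) (x y : path_space int A).

Let P1 : P setT = 1%E. Proof. exact: probability_setT. Qed.

Let L : R := 2 * (#|` G| + #|` D|)%:R.

Let L_gt0 : 0 < L.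
Proof. by rewrite mulr_gt0// ltr0n card_windows_gt0. Qed.

Let indicator a (u : {ffun G -> A}) : R := (u == a)%:R.

Let indicator_le1 a u : `|indicator a u| <= 1.
Proof. by rewrite /indicator; case: (_ == _); rewrite ?normr1 ?normr0. Qed.

Definition deviation a x : R :=
  tally n b (fun u => (u == a)%:R) x - fit_count D G n * joint P b a.

Lemma sample_bounded_measurable F : sample_dependent n F ->
  (exists M, forall x, `|F x| <= M) -> bounded_measurable (F : _ -> R).
Proof. by move=> Fn bF; split=> //; exact: sample_dependent_measurable Fn. Qed.

Let bounded_tally (phi : {ffun G -> A} -> R) : (forall u, `|phi u| <= 1) ->
  bounded_measurable (tally n b phi : path_space int A -> R).
Proof.
move=> phi_le1; apply: sample_bounded_measurable.
  exact: lipschitz_sample_dependent (tally_lipschitz min_le n b phi_le1).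
by exists n%:R => x; exact: tally_bounded.
Qed.

Let bounded_deviation a : bounded_measurable (deviation a).
Proof.
apply: bounded_measurableD; last exact: bounded_measurable_cst.
exact/bounded_tally/indicator_le1.
Qed.

Lemma joint_ge0 a : 0 <= joint P b a.
Proof. by rewrite fine_ge0. Qed.

Lemma joint_le1 a : joint P b a <= 1.
Proof.
have mJ := measurable_joint A_countable b a.
by rewrite -lee_fin fineK ?fin_num_measure// probability_le1.
Qed.

Let deviation_bounded a x : `|deviation a x| <= n%:R + n%:R.
Proof.
apply: le_trans (ler_normB _ _) _; apply: lerD.
  exact/tally_bounded/indicator_le1.
have fit_ge0 : 0 <= fit_count (R := R) D G n by exact: sumr_ge0.
rewrite ger0_norm ?mulr_ge0// ?joint_ge0//.
apply: le_trans (fit_count_le D G n).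
by rewrite ler_piMr// joint_le1.
Qed.

Let V : R := n.+1%:R * (L / gamma) ^+ 2.

(** A signed sum of counts is a tally whose weight takes the signs as values, so
    that it obeys the same variance bound as a single count. *)
Lemma sum_deviation_second_moment_le (s : seq {ffun G -> A}) : uniq s ->
  \sum_(a <- s) \int[P]_x deviation a x ^+ 2 <= V.
Proof.
move=> uniq_s.
have := @sum_second_moment_le _ _ _ P P1 _ s deviation (fun=> 0) V uniq_s
  bounded_deviation (bounded_measurable_cst 0).
under eq_Rintegral do rewrite expr0n.
rewrite (mean_cst P1) add0r; apply => e e_le1.
pose phi u : R := \sum_(a <- s) e a * indicator a u.
have phi_le1 u : `|phi u| <= 1.
  have [us|us] := boolP (u \in s).
    rewrite /phi (bigD1_seq u)//= big1 ?addr0.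
      by rewrite /indicator eqxx mulr1.
    by move=> a au; rewrite /indicator eq_sym (negbTE au) mulr0.
  rewrite /phi big_seq big1 ?normr0// => a as_.
  by rewrite /indicator; case: eqP => ?; [move: us; subst; rewrite as_|rewrite mulr0].
have tallyE x : tally n b phi x = \sum_(a <- s) e a * tally n b (indicator a) x.
  rewrite /tally /phi; under eq_bigr do rewrite mulr_sumr.
  rewrite exchange_big /=; apply: eq_bigr => a _.
  by rewrite mulr_sumr; apply: eq_bigr => i _; rewrite mulrCA.
have mean_phi : \int[P]_x tally n b phi x =
    \sum_(a <- s) e a * (fit_count D G n * joint P b a).
  under eq_Rintegral do rewrite tallyE.
  rewrite (mean_sum P1); last first.
    by move=> a; exact/bounded_measurableZ/bounded_tally/indicator_le1.
  apply: eq_bigr => a _; rewrite (meanZ P1); last exact/bounded_tally/indicator_le1.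
  by rewrite (mean_tally A_countable P_stationary).
have phi_bounded : exists M, forall x, `|tally n b phi x| <= M.
  by exists n%:R => x; exact: tally_bounded.
have := variance_sample_le A_countable P_stationary p_version gamma_gt0 gamma_le
  L_gt0 (tally_lipschitz min_le n b phi_le1) phi_bounded.
apply: le_trans; rewrite le_eqVlt; apply/orP; left; apply/eqP.
apply: eq_Rintegral => x _; congr (_ ^+ 2).
rewrite add0r mean_phi tallyE -sumrB; apply: eq_bigr => a _.
by rewrite -mulrBr.
Qed.

Definition spread x : R :=
  sup [set deviation w.1 x - deviation w.2 x | w in [set: {ffun G -> A} * {ffun G -> A}]].

Let spread_ub x : has_ubound
  [set deviation w.1 x - deviation w.2 x | w in [set: {ffun G -> A} * {ffun G -> A}]].
Proof.
exists (n%:R + n%:R + (n%:R + n%:R)) => _ [[a a'] _ <-] /=.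
apply: le_trans (ler_norm _) _; apply: le_trans (ler_normB _ _) _.
by rewrite lerD.
Qed.

Lemma deviation_le_spread a a' x : deviation a x - deviation a' x <= spread x.
Proof. by apply: ub_le_sup; [exact: spread_ub|exists (a, a')]. Qed.

Let a0 : {ffun G -> A} := [ffun=> point].

Let spread_le x r : (forall a a', deviation a x - deviation a' x <= r) ->
  spread x <= r.
Proof.
move=> le_r; apply: ge_sup; first by exists (deviation a0 x - deviation a0 x), (a0, a0).
by move=> _ [[a a'] _ <-]; exact: le_r.
Qed.

Lemma spread_ge0 x : 0 <= spread x.
Proof. by have := deviation_le_spread a0 a0 x; rewrite subrr. Qed.

Lemma spread_lipschitz : lipschitz_sample n L spread.
Proof.
move=> x y; rewrite lerBlDr; apply: spread_le => a a'.
have half u v : `|(indicator a u - indicator a' v) : R| <= 1.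
  rewrite /indicator; case: (_ == _); case: (_ == _);
  by rewrite ?subrr ?subr0 ?sub0r ?normrN ?normr1 ?normr0.
have tallyB z : tally n b (fun u => indicator a u - indicator a' u) z =
    tally n b (indicator a) z - tally n b (indicator a') z.
  by rewrite /tally -sumrB; apply: eq_bigr => i _; rewrite mulrBr.
have := tally_lipschitz min_le n b (fun u => half u u) x y; rewrite !tallyB.
have := deviation_le_spread a a' y.
by rewrite /deviation -/L /indicator; lra.
Qed.

Let spread_bounded : exists M, forall x, `|spread x| <= M.
Proof.
exists (n%:R + n%:R + (n%:R + n%:R)) => x; rewrite ger0_norm ?spread_ge0//.
apply: spread_le => a a'.
apply: le_trans (ler_norm _) _; apply: le_trans (ler_normB _ _) _.
by rewrite lerD.
Qed.

Lemma bounded_measurable_spread : bounded_measurable spread.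
Proof.
by apply: sample_bounded_measurable spread_bounded;
  exact: lipschitz_sample_dependent spread_lipschitz.
Qed.

(** The square of the spread is at most four times the sum of the squared
    deviations over all guesses; the alphabet may be infinite, and this sum is
    integrated term by term along an enumeration of the guesses. *)
Lemma mean_spread_sq_le : \int[P]_x spread x ^+ 2 <= 4 * V.
Proof.
have [code [decode codeK]] := countable_decode a0 (countable_ffun A_countable G).
have bsq := bounded_measurableX bounded_measurable_spread.
have bdev a := bounded_measurableX (bounded_deviation a).
pose term k x : \bar R :=
  if code (decode k) == k then (deviation (decode k) x ^+ 2)%:E else 0%E.
have term_ge0 k x : (0 <= term k x)%E.
  by rewrite /term; case: ifP => // _; rewrite lee_fin sqr_ge0.
have mterm k : measurable_fun setT (term k).
  rewrite /term; case: (_ == k); last exact: measurable_cst.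
  by apply/measurable_EFinP; exact: (bdev _).1.
have sq_le x : ((spread x ^+ 2)%:E <= 4%:E * \sum_(k <oo) term k x)%E.
  have dev_le a : ((deviation a x ^+ 2)%:E <= \sum_(k <oo) term k x)%E.
    apply: (@le_trans _ _ (\sum_(0 <= k < (code a).+1) term k x)%E).
      rewrite big_nat_recr//= {2}/term codeK eqxx leeDr//.
      by apply: sume_ge0 => k _; exact: term_ge0.
    by apply: nneseries_lim_ge => k _.
  have : (0 <= \sum_(k <oo) term k x)%E by exact: nneseries_ge0.
  move: dev_le; set S := (\sum_(k <oo) term k x)%E; clearbody S.
  case: S => [r| |] // dev_le r_ge0; last first.
    by rewrite mulry gtr0_sg// mul1e leey.
  rewrite -EFinM lee_fin.
  have dev_sqrt a : `|deviation a x| <= Num.sqrt r.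
    by rewrite -sqrtr_sqr ler_wsqrtr//; have := dev_le a; rewrite lee_fin.
  have spread_sqrt : spread x <= 2 * Num.sqrt r.
    apply: spread_le => a a'.
    have := dev_sqrt a; have := dev_sqrt a'.
    by rewrite !ler_norml => /andP[? ?] /andP[? ?]; lra.
  have -> : 4 * r = (2 * Num.sqrt r) ^+ 2.
    by rewrite exprMn sqr_sqrtr//; ring.
  by rewrite lerXn2r// nnegrE ?spread_ge0// mulr_ge0// sqrtr_ge0.
rewrite -lee_fin (EFin_mean P1)//.
apply: (@le_trans _ _ (\int[P]_x (4%:E * \sum_(k <oo) term k x))%E).
  apply: ge0_le_integral => //.
  - by move=> x _; rewrite lee_fin sqr_ge0.
  - by apply/measurable_EFinP; exact: bsq.1.
  - apply: measurable_funeM; apply: (@ge0_emeasurable_sum _ _ _ _ term predT) => //.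
rewrite ge0_integralZl//; last 2 first.
- by apply: (@ge0_emeasurable_sum _ _ _ _ term predT).
- by move=> x _; exact: nneseries_ge0.
rewrite EFinM lee_wpmul2l// (@integral_nneseries _ _ _ P _ _ term)//.
apply: lime_le.
  by apply: is_cvg_nneseries => k _ _; apply: integral_ge0.
apply: nearW => N.
pose s := [seq decode k | k <- iota 0 N & code (decode k) == k].
have uniq_s : uniq s.
  rewrite map_inj_in_uniq ?filter_uniq ?iota_uniq// => k l.
  rewrite !mem_filter => /andP[/eqP kE _] /andP[/eqP lE _] kl.
  by rewrite -kE -lE kl.
apply: le_trans (_ : (\sum_(a <- s) \int[P]_x deviation a x ^+ 2)%:E <= _)%E; last first.
  by rewrite lee_fin sum_deviation_second_moment_le.
rewrite le_eqVlt; apply/orP; left; apply/eqP.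
rewrite /s big_map big_filter [RHS](_ : _ = \sum_(k <- iota 0 N | code (decode k) == k)
   (\int[P]_x (deviation (decode k) x ^+ 2)%:E))%E; last first.
  by rewrite -sumEFin; apply: eq_bigr => k _; rewrite (EFin_mean P1).
rewrite [RHS]big_mkcond /index_iota subn0; apply: eq_bigr => k _.
by rewrite /term; case: (_ == k) => //; rewrite integral_cst// mul0e.
Qed.

Lemma mean_spread_le : \int[P]_x spread x <= 2 * (L / gamma) * Num.sqrt n.+1%:R.
Proof.
have bZ := bounded_measurable_spread.
set m := \int[P]_x spread x.
have c_ge0 : 0 <= 2 * (L / gamma) * Num.sqrt n.+1%:R.
  by rewrite !mulr_ge0// ?sqrtr_ge0 ?invr_ge0 ?(ltW gamma_gt0) ?(ltW L_gt0).
have m_ge0 : 0 <= m by apply: Rintegral_ge0 => x _; exact: spread_ge0.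
rewrite -ler_sqr ?nnegrE//.
apply: (@le_trans _ _ (4 * V)); last first.
  rewrite /V !exprMn sqr_sqrtr// le_eqVlt; apply/orP; left; apply/eqP.
  by ring.
apply: le_trans mean_spread_sq_le.
have sqE x : spread x ^+ 2 = (spread x - m) ^+ 2 + (2 * m * spread x + - m ^+ 2).
  by ring.
under eq_Rintegral do rewrite sqE.
have bZ2 : bounded_measurable (fun x => (spread x - m) ^+ 2).
  exact/bounded_measurableX/bounded_measurableD/bounded_measurable_cst.
rewrite (meanD P1)//; last first.
  apply: bounded_measurableD; [exact: bounded_measurableZ|exact: bounded_measurable_cst].
rewrite (meanD P1) ?(mean_cst P1) ?(meanZ P1)//; last 2 first.
- exact: bounded_measurableZ.
- exact: bounded_measurable_cst.
have : 0 <= \int[P]_x (spread x - m) ^+ 2.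
  by apply: Rintegral_ge0 => x _; exact: sqr_ge0.
by rewrite -/m; lra.
Qed.

Lemma mgf_spread_le s : \int[P]_x expR (s * spread x) <=
  expR (s * \int[P]_x spread x + n.+1%:R * (s ^+ 2 * (L / gamma) ^+ 2 / 4)).
Proof.
exact: (mgf_sample_le A_countable P_stationary p_version gamma_gt0 gamma_le L_gt0
  s spread_lipschitz spread_bounded).
Qed.

End Spread.

(** * The excess risk as a mean regret *)

Section ExcessRisk.
Context {R : realType} {A : pointedType}.
Hypothesis A_countable : countable [set: A].
Variables (D G : {fset int}).
Variable P : probability (path_space int A) R.
Implicit Types (b : {ffun D -> A}) (a : {ffun G -> A}) (x : path_space int A).

Let P1 : P setT = 1%E. Proof. exact: probability_setT. Qed.

Let measurable_miss b a :
  measurable [set x : path_space int A | pattern G x <> a /\ pattern D x = b].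
Proof.
exact: (measurable_patterns A_countable (fun d (g : {ffun G -> A}) => g <> a /\ d = b)).
Qed.

Let measurable_pattern b :
  measurable [set x : path_space int A | pattern D x = b].
Proof.
exact: (measurable_patterns A_countable (fun d (_ : {ffun G -> A}) => d = b)).
Qed.

Lemma EFin_miss b a : (miss P b a)%:E =
  P [set x : path_space int A | pattern G x <> a /\ pattern D x = b].
Proof. by rewrite fineK// fin_num_measure. Qed.

Lemma missE b a :
  miss P b a = pr P [set x : path_space int A | pattern D x = b] - joint P b a.
Proof.
have mJ := measurable_joint A_countable b a.
apply/eqP; rewrite -subr_eq opprK -eqe EFinD EFin_miss.
rewrite /joint /pr !fineK ?fin_num_measure// -measureU//.
  apply/eqP; congr (P _); apply/seteqP; split => x /=; first by case=> -[].
  by move=> Dx; have [Gx|Gx] := pselect (pattern G x = a); [right|left].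
by apply/seteqP; split => x //= -[[ne _] [Gx _]]; exact: ne.
Qed.

Lemma miss_ge0 b a : 0 <= miss P b a.
Proof. by rewrite fine_ge0. Qed.

Lemma miss_le1 b a : miss P b a <= 1.
Proof. by rewrite -lee_fin EFin_miss probability_le1. Qed.

Definition regret b a := miss P b a - inf [set miss P b c | c in [set: {ffun G -> A}]].

Let miss_lb b : has_lbound [set miss P b c | c in [set: {ffun G -> A}]].
Proof. by exists 0 => _ [c _ <-]; exact: miss_ge0. Qed.

Lemma regret_le b a r :
  (forall c : {ffun G -> A}, joint P b c - joint P b a <= r) -> regret b a <= r.
Proof.
move=> le_r; rewrite lerBlDr -lerBlDl; apply: lb_le_inf.
  by exists (miss P b a), a.
by move=> _ [c _ <-]; have := le_r c; rewrite !missE; lra.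
Qed.

Lemma regret_ge0 b a : 0 <= regret b a.
Proof. by rewrite subr_ge0; apply: ge_inf; [exact: miss_lb|exists a]. Qed.

Lemma regret_le1 b a : regret b a <= 1.
Proof.
apply: le_trans (miss_le1 b a); rewrite gerBl; apply: lb_le_inf.
  by exists (miss P b a), a.
by move=> _ [c _ <-]; exact: miss_ge0.
Qed.

(** The margin is an infimum of positive regrets. *)
Lemma margin_le_regret b a : 0 < regret b a -> margin D G P <= regret b a.
Proof.
move=> regret_gt0.
have margin_at_ge0 b' : 0 <= margin_at G P b'.
  rewrite /margin_at; set S := [set r | _].
  have [->|/set0P S0] := eqVneq S set0; first by rewrite inf0.
  by apply: lb_le_inf => // r [/ltW].
apply: (@le_trans _ _ (margin_at G P b)); apply: ge_inf.
- by exists 0 => _ [b' _ <-].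
- by exists b.
- by exists 0 => r [/ltW].
- by split=> //; exists a.
Qed.

Lemma regret_le_beta b a : regret b a <= beta_coef D G P.
Proof.
have joint_ub b' : has_ubound [set joint P b' c | c in [set: {ffun G -> A}]].
  by exists 1 => _ [c _ <-]; exact: joint_le1.
have joint_lb b' : has_lbound [set joint P b' c | c in [set: {ffun G -> A}]].
  by exists 0 => _ [c _ <-]; exact: joint_ge0.
apply: (@le_trans _ _ (sup [set joint P b c | c in [set: {ffun G -> A}]] -
    inf [set joint P b c | c in [set: {ffun G -> A}]])).
  apply: regret_le => c; apply: lerB.
    by apply: ub_le_sup => //; exists c.
  by apply: ge_inf => //; exists a.
apply: ub_le_sup; last by exists b.
exists 1 => _ [b' _ <-].
have sup_le1 : sup [set joint P b' c | c in [set: {ffun G -> A}]] <= 1.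
  apply: ge_sup; first by exists (joint P b' a), a.
  by move=> _ [c _ <-]; exact: joint_le1.
apply: le_trans sup_le1; rewrite gerBl; apply: lb_le_inf.
  by exists (joint P b' a), a.
by move=> _ [c _ <-]; exact: joint_ge0.
Qed.

(** By definition of the product measure, after conditioning on the sample. *)
Let section_miss (h : path_space int A -> {ffun D -> A} -> {ffun G -> A}) b :
  ((P \x P)%E ([set w : path_space int A * path_space int A |
      h w.1 (pattern D w.2) <> pattern G w.2] `&`
    [set w : path_space int A * path_space int A | pattern D w.2 = b]) =
   \int[P]_x (miss P b (h x b))%:E)%E.
Proof.
rewrite /product_measure1; apply: eq_integral => x _ /=.
rewrite EFin_miss; congr (P _); apply/seteqP; split => y; rewrite /xsection /= inE.
  by move=> [/= ne Dy]; split=> //; rewrite -Dy => /esym.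
by move=> [ne Dy]; split=> //=; rewrite Dy => /esym.
Qed.

Variables (n : nat) (f : n.-tuple A -> {ffun D -> A} -> {ffun G -> A}).

Let sample_miss b : sample_dependent n (fun x : path_space int A => f (sample n x) b).
Proof.
by move=> x y xy; congr f; apply: eq_mktuple => i; exact: xy.
Qed.

Lemma bounded_measurable_regret b :
  bounded_measurable (fun x : path_space int A => regret b (f (sample n x) b)).
Proof.
apply: (sample_bounded_measurable A_countable (n := n)).
  by move=> x y xy; rewrite (sample_miss b xy).
by exists 1 => x; rewrite ger0_norm ?regret_ge0// regret_le1.
Qed.

(** Multiplying by the probability of [b] undoes the conditioning. *)
Lemma excess_risk_le r :
  (forall b, \int[P]_x regret b (f (sample n x) b) <= r) -> excess_risk P f <= r.
Proof.
move=> regret_r; apply: ge_sup; first by eexists; exists [ffun=> point].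
move=> _ [b _ <-]; cbv zeta; apply: le_trans (regret_r b).
set q := inf [set miss P b c | c in [set: {ffun G -> A}]].
pose m x := miss P b (f (sample n x) b).
have bm : bounded_measurable (m : path_space int A -> R).
  apply: (sample_bounded_measurable A_countable (n := n)).
    by move=> x y xy; rewrite /m (sample_miss b xy).
  by exists 1 => x; rewrite ger0_norm ?miss_ge0// miss_le1.
have regretE : \int[P]_x regret b (f (sample n x) b) = \int[P]_x m x - q.
  rewrite -(mean_cst P1 (- q)) -(meanD P1)//; exact: bounded_measurable_cst.
pose pb := pr P [set x : path_space int A | pattern D x = b].
have pbE : fine ((P \x P)%E
    [set w : path_space int A * path_space int A | pattern D w.2 = b]) = pb.
  congr fine; rewrite /product_measure1 -[RHS]mule1 -P1 -integral_cst//.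
  apply: eq_integral => x _ /=; congr (P _).
  by apply/seteqP; split => y; rewrite /xsection /= inE.
have pb_ge0 : 0 <= pb by rewrite fine_ge0.
have [pb0|pb_neq0] := eqVneq pb 0.
  rewrite pbE pb0 mulr0; apply: Rintegral_ge0 => x _; exact: regret_ge0.
have pb_gt0 : 0 < pb by rewrite lt_neqAle eq_sym pb_neq0.
rewrite regretE -ler_pdivlMr ?pbE// mulrBl.
rewrite /cpr pbE (section_miss (fun x b' => f (sample n x) b')).
rewrite -/(Rintegral P setT _) lerD2l lerN2.
apply: lb_le_inf; first by eexists; exists [ffun=> point].
move=> _ [a _ <-]; rewrite (section_miss (fun _ _ => a)).
rewrite ler_pM2r ?invr_gt0// -/(Rintegral P setT _) (mean_cst P1).
by apply: ge_inf; [exact: miss_lb|exists a].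
Qed.

End ExcessRisk.

(** * Rates *)

Section RateBounds.
Context {R : realType} {A : pointedType}.
Hypothesis A_countable : countable [set: A].
Variables (D G : {fset int}).
Hypothesis min_in : 1 \in (G `|` D)%fset.
Hypothesis min_le : forall j : int, j \in (G `|` D)%fset -> 1 <= j.
Variable P : probability (path_space int A) R.
Hypothesis P_stationary : stationary P.
Variable p : A -> path_space nat A -> R.
Hypothesis p_version : left_conditional_version P p.
Variable gamma : R.
Hypothesis gamma_gt0 : 0 < gamma.
Hypothesis gamma_le : gamma <= Gamma_coef p.
Variables (n : nat) (f : n.-tuple A -> {ffun D -> A} -> {ffun G -> A}).
Hypothesis f_max : forall (x : int -> A) b (a : {ffun G -> A}),
  (occurrences n x b a)%:R / n%:R <=
  (occurrences n x b (f (sample n x) b))%:R / n%:R :> R.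
Implicit Types (b : {ffun D -> A}) (x : path_space int A).

Let P1 : P setT = 1%E. Proof. exact: probability_setT. Qed.
Let m : R := fit_count D G n.
Let c : R := 2 * (#|` G| + #|` D|)%:R / gamma.
Hypothesis m_gt0 : 0 < m.

Let n_gt0 : 0 < (n%:R : R).
Proof. exact: lt_le_trans m_gt0 (fit_count_le D G n). Qed.

(** The selected guess occurs at least as often as any other, so that only the
    fluctuations of the counts can make it worse than another one. *)
Lemma regret_le_spread b x :
  m * regret P b (f (sample n x) b) <= spread G P n b x.
Proof.
rewrite mulrC -ler_pdivlMr//; apply: regret_le => // a.
rewrite ler_pdivlMr//.
have := deviation_le_spread A_countable P n b (f (sample n x) b) a x.
have := f_max x b a; rewrite ler_pM2r ?invr_gt0// !occurrencesE.
rewrite /deviation -/m; lra.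
Qed.

Let spread_bm b : bounded_measurable (spread G P n b).
Proof. exact: bounded_measurable_spread. Qed.

Lemma mean_regret_le b :
  \int[P]_x regret P b (f (sample n x) b) <= 2 * c * Num.sqrt n.+1%:R / m.
Proof.
rewrite ler_pdivlMr// mulrC -(meanZ P1); last exact: bounded_measurable_regret.
apply: le_trans (mean_spread_le A_countable min_in min_le P_stationary p_version
  gamma_gt0 gamma_le n b).
apply: (mean_le P1) => //; last by move=> x; exact: regret_le_spread.
exact/bounded_measurableZ/bounded_measurable_regret.
Qed.

(** Pointwise, [regret <= exp(s (spread - m margin))]: a positive regret [r] is
    at most [1], and [m margin <= m r <= spread]. *)
Lemma mean_regret_le_exp b (s : R) : 0 <= s ->
  \int[P]_x regret P b (f (sample n x) b) <=
  expR (s * (2 * c * Num.sqrt n.+1%:R - m * margin D G P) +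
        n.+1%:R * (s ^+ 2 * c ^+ 2 / 4)).
Proof.
move=> s_ge0; set delta := margin D G P.
have pointwise x : regret P b (f (sample n x) b) <=
    expR (- (s * (m * delta))) * expR (s * spread G P n b x).
  rewrite -expRD; set r := regret _ _ _.
  have : 0 <= r by exact: regret_ge0.
  rewrite le_eqVlt => /predU1P[<-|r_gt0]; first exact: expR_ge0.
  apply: le_trans (regret_le1 A_countable P b _) _.
  rewrite -[leLHS]expR0 ler_expR addrC subr_ge0 ler_wpM2l//.
  apply: le_trans (regret_le_spread b x); rewrite ler_pM2l//.
  exact: margin_le_regret.
apply: (@le_trans _ _ (\int[P]_x
    (expR (- (s * (m * delta))) * expR (s * spread G P n b x)))).
  apply: (mean_le P1) => //; first exact: bounded_measurable_regret.
  exact/bounded_measurableZ/bounded_measurable_expR.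
rewrite (meanZ P1); last exact: bounded_measurable_expR.
have := mgf_spread_le A_countable min_in min_le P_stationary p_version
  gamma_gt0 gamma_le n b s.
move=> /(ler_wpM2l (expR_ge0 (- (s * (m * delta))))) /le_trans; apply.
rewrite -expRD ler_expR.
have := mean_spread_le A_countable min_in min_le P_stationary p_version
  gamma_gt0 gamma_le n b.
rewrite -/c => /(ler_wpM2l s_ge0).
by rewrite mulrBr; lra.
Qed.

Lemma mean_regret_le_beta b :
  \int[P]_x regret P b (f (sample n x) b) <= beta_coef D G P.
Proof.
rewrite -[leRHS](mean_cst P1); apply: (mean_le P1).
- exact: bounded_measurable_regret.
- exact: bounded_measurable_cst.
- by move=> x; exact: regret_le_beta.
Qed.

End RateBounds.

Section Asymptotics.
Context {R : realType}.
Implicit Types (c m delta t : R) (n : nat).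

Lemma ln_ge_eventually t : exists N : nat, forall n, (N <= n)%N -> t <= ln (n%:R : R).
Proof.
exists (Num.bound (expR t)) => n Nn.
have en : expR t <= n%:R.
  apply: ltW; apply: lt_le_trans (archi_boundP (expR_ge0 t)) _.
  by rewrite ler_nat.
rewrite -(expRK t) ler_ln ?posrE ?expR_gt0//.
exact: lt_le_trans (expR_gt0 t) en.
Qed.

(** As [n / 2 <= m] and [n + 1 <= 2 n], the square of the left side is at most
    [32 c^2 / n]; that of the right side is [ln n / (4 n)]. *)
Lemma slow_rate_le c m n : 0 <= c -> (2 <= n)%N -> n%:R / 2 <= m ->
  128 * c ^+ 2 <= ln (n%:R : R) ->
  2 * c * Num.sqrt n.+1%:R / m <= 2^-1 * Num.sqrt (ln (n%:R : R) / n%:R).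
Proof.
move=> c_ge0 n_ge2 m_ge ln_ge.
have n2 : 2 <= (n%:R : R) by rewrite ler_nat.
have n_gt0 : 0 < (n%:R : R) by lra.
have m_gt0 : 0 < m by lra.
have ln_ge0 : 0 <= ln (n%:R : R) by apply: ln_ge0; lra.
rewrite ler_pdivrMr// -ler_sqr ?nnegrE ?mulr_ge0 ?sqrtr_ge0 ?invr_ge0//; last first.
  exact: ltW.
rewrite !exprMn !sqr_sqrtr ?divr_ge0 ?ler0n//.
set l := ln _ in ln_ge ln_ge0 *.
have m_sq : (n%:R / 2) ^+ 2 <= m ^+ 2.
  by rewrite ler_sqr ?nnegrE ?divr_ge0 ?ler0n// ltW.
apply: (@le_trans _ _ (2^-1 ^+ 2 * (l / n%:R) * (n%:R / 2) ^+ 2)); last first.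
  by rewrite ler_wpM2l// !mulr_ge0 ?invr_ge0 ?ler0n ?sqr_ge0.
have -> : 2^-1 ^+ 2 * (l / n%:R) * (n%:R / 2) ^+ 2 = n%:R * l / 16.
  by field; rewrite gt_eqF.
apply: (@le_trans _ _ (n%:R * (128 * c ^+ 2) / 16)); last first.
  by rewrite ler_wpM2r ?invr_ge0// ler_wpM2l// ltW.
rewrite -natr1; have := sqr_ge0 c; set C := c ^+ 2 => C_ge0; nra.
Qed.

(** [s] minimizes the exponent, and the minimum is
    [- (m delta - EZ)^2 / ((n + 1) c^2)].  The hypotheses ensure that [EZ] and
    [(n - m) delta] are each at most [n delta / 16]; this leaves
    [(7 / 8)^2 n^2 delta^2], and [(7 / 8)^2 > 1 / 2]. *)
Lemma fast_rate_exponent c m n delta (EZ := 2 * c * Num.sqrt n.+1%:R)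
    (s := 2 * (m * delta - EZ) / (n.+1%:R * c ^+ 2)) :
  0 < c -> (2 <= n)%N -> 15 / 16 * n%:R <= m -> 0 < delta ->
  2048 * c ^+ 2 <= n%:R * delta ^+ 2 ->
  0 <= s /\ s * (EZ - m * delta) + n.+1%:R * (s ^+ 2 * c ^+ 2 / 4) <=
    - (n%:R * delta ^+ 2 / (2 * c ^+ 2)).
Proof.
move=> c_gt0 n_ge2 m_ge delta_gt0 c_le.
have n2 : 2 <= (n%:R : R) by rewrite ler_nat.
have n_gt0 : 0 < (n%:R : R) by lra.
have c2_gt0 : 0 < c ^+ 2 by rewrite exprn_gt0.
have EZ_le : EZ <= n%:R * delta / 16.
  rewrite -ler_sqr ?nnegrE; first last.
  - by rewrite !mulr_ge0 ?invr_ge0// ltW.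
  - by rewrite /EZ !mulr_ge0 ?sqrtr_ge0// ltW.
  rewrite /EZ !exprMn sqr_sqrtr// -natr1.
  have /(ler_wpM2l (ltW n_gt0)) := c_le.
  by set C := c ^+ 2 in c2_gt0 *; set d := delta ^+ 2; nra.
have gap_ge : 7 / 8 * (n%:R * delta) <= m * delta - EZ.
  by have := ler_wpM2r (ltW delta_gt0) m_ge; lra.
have gap_ge0 : 0 <= m * delta - EZ.
  by apply: le_trans gap_ge; rewrite !mulr_ge0// ltW.
have denom_gt0 : 0 < n.+1%:R * c ^+ 2 by rewrite mulr_gt0.
split; first by rewrite /s divr_ge0// ?mulr_ge0// ltW.
have -> : s * (EZ - m * delta) + n.+1%:R * (s ^+ 2 * c ^+ 2 / 4) =
    - ((m * delta - EZ) ^+ 2 / (n.+1%:R * c ^+ 2)).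
  by rewrite /s; field; rewrite gt_eqF//= pnatr_eq0.
rewrite lerN2 ler_pdivrMr ?mulr_gt0// mulrAC ler_pdivlMr//.
have gap_sq : (7 / 8 * (n%:R * delta)) ^+ 2 <= (m * delta - EZ) ^+ 2.
  by rewrite ler_sqr// nnegrE !mulr_ge0// ltW.
apply: (@le_trans _ _ ((7 / 8 * (n%:R * delta)) ^+ 2 * (2 * c ^+ 2))); last first.
  by rewrite ler_wpM2r// mulr_ge0// ltW.
rewrite -natr1 !exprMn [n%:R * delta ^+ 2 * _]mulrA [X in _ <= X]mulrA.
rewrite ler_pM2r//.
have d_gt0 : 0 < delta ^+ 2 by rewrite exprn_gt0.
set d := delta ^+ 2 in d_gt0 *.
rewrite [leLHS](_ : _ = (n%:R * (n%:R + 1)) * d); last by ring.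
rewrite [leRHS](_ : _ = (49 / 32 * n%:R ^+ 2) * d); last by field.
by rewrite ler_pM2r// expr2; nra.
Qed.

End Asymptotics.

Theorem corollary3p1 (R : realType) (A : pointedType)
  (A_countable : countable [set: A])
  (A_two : exists a a' : A, a <> a')
  (G D : {fset int})
  (min_in : 1 \in (G `|` D)%fset)
  (min_le : forall j : int, j \in (G `|` D)%fset -> 1 <= j)
  (P : nat -> probability (path_space int A) R)
  (p : nat -> A -> path_space nat A -> R)
  (P_stationary : forall n, (1 <= n)%N -> stationary (P n))
  (p_version : forall n, (1 <= n)%N -> left_conditional_version (P n) (p n))
  (gamma : R) (gamma_gt0 : 0 < gamma)
  (Gamma_ge : forall n, (2 <= n)%N -> gamma <= Gamma_coef (p n))
  (f : forall n, n.-tuple A -> {ffun D -> A} -> {ffun G -> A})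
  (f_estimator : is_estimator R f) :
  let delta := fun n : nat => margin D G (P n) in
  ((fun n : nat => delta n * Num.sqrt (n%:R / ln (n%:R : R))) @ \oo --> (0 : R) ->
    exists n0 : nat, (2 <= n0)%N /\
      forall n : nat, (n0 <= n)%N ->
        excess_risk (P n) (@f n) <=
        Num.min (2^-1 * Num.sqrt (ln (n%:R : R) / n%:R)) (beta_coef D G (P n)))
  /\
  ((fun n : nat => delta n * Num.sqrt (n%:R / ln (n%:R : R))) @ \oo --> +oo ->
    exists n0 : nat, (1 <= n0)%N /\
      forall n : nat, (n0 <= n)%N ->
        excess_risk (P n) (@f n) <=
        Num.min
          (expR (- (gamma ^+ 2 * n%:R * delta n ^+ 2 /
                    (8 * (#|` G| + #|` D|)%:R ^+ 2))))
          (beta_coef D G (P n))).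
Proof.
move=> delta.
pose c : R := 2 * (#|` G| + #|` D|)%:R / gamma.
have K_gt0 : 0 < (#|` G| + #|` D|)%:R :> R by rewrite ltr0n card_windows_gt0.
have c_gt0 : 0 < c by rewrite divr_gt0// mulr_gt0.
have [M fit_ge] := @fit_count_ge R D G min_le.
have fit_large (n : nat) : (2 <= n)%N -> (16 * M <= n)%N ->
    15 / 16 * (n%:R : R) <= fit_count D G n.
  move=> _ Mn; apply: le_trans (fit_ge n).
  have : (16 * M)%:R <= (n%:R : R) by rewrite ler_nat.
  by rewrite natrM; lra.
have fit_gt0 (n : nat) : (2 <= n)%N -> (16 * M <= n)%N ->
    0 < fit_count D G n :> R.
  move=> n2 Mn; apply: lt_le_trans (fit_large n n2 Mn).
  by rewrite mulr_gt0// ltr0n; lia.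
split=> [_|delta_cvg].
  have [N ln_ge] := ln_ge_eventually (128 * c ^+ 2).
  exists (maxn 2 (maxn (16 * M) N)); split; first by rewrite leq_maxl.
  move=> n; rewrite !geq_max => /and3P[n2 Mn Nn].
  have n1 : (1 <= n)%N by apply: leq_trans n2.
  have m_gt0 := fit_gt0 n n2 Mn.
  apply: excess_risk_le => // b; rewrite le_min; apply/andP; split; last first.
    exact: mean_regret_le_beta.
  apply: le_trans (mean_regret_le A_countable min_in min_le (P_stationary n n1)
    (p_version n n1) gamma_gt0 (Gamma_ge n n2) (f_estimator n) m_gt0 b) _.
  apply: slow_rate_le => //; [exact: ltW| |exact: ln_ge].
  apply: le_trans (fit_large n n2 Mn).
  by have := ler0n R n; lra.
have [N ln_ge] := ln_ge_eventually (2048 * c ^+ 2).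
have /cvgryPge/(_ 1)[N1 _ delta_ge] := delta_cvg.
exists (maxn 2 (maxn (16 * M) (maxn N N1))); split; first by rewrite leq_max.
move=> n; rewrite !geq_max => /and4P[n2 Mn Nn N1n].
have n1 : (1 <= n)%N by apply: leq_trans n2.
have m_gt0 := fit_gt0 n n2 Mn.
have n_gt0 : 0 < (n%:R : R) by rewrite ltr0n.
have ln_gt0 : 0 < ln (n%:R : R) by rewrite ln_gt0// ltr1n.
have := delta_ge n N1n; rewrite /= => delta_sqrt_ge.
have delta_gt0 : 0 < delta n.
  rewrite ltNge; apply/negP => delta_le0.
  have := mulr_le0_ge0 delta_le0 (sqrtr_ge0 (n%:R / ln (n%:R : R))).
  by move=> /(le_trans delta_sqrt_ge); rewrite ler10.
have delta_sq_ge : ln (n%:R : R) <= n%:R * delta n ^+ 2.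
  have : 1 ^+ 2 <= (delta n * Num.sqrt (n%:R / ln (n%:R : R))) ^+ 2.
    by rewrite ler_sqr ?nnegrE// mulr_ge0 ?sqrtr_ge0// ltW.
  rewrite expr1n exprMn sqr_sqrtr; last by rewrite divr_ge0// ltW.
  by rewrite mulrA ler_pdivlMr// mul1r mulrC.
have c_le : 2048 * c ^+ 2 <= n%:R * delta n ^+ 2.
  exact: le_trans (ln_ge n Nn) delta_sq_ge.
have [s_ge0 exponent_le] :=
  fast_rate_exponent c_gt0 n2 (fit_large n n2 Mn) delta_gt0 c_le.
apply: excess_risk_le => // b; rewrite le_min; apply/andP; split; last first.
  exact: mean_regret_le_beta.
apply: le_trans (mean_regret_le_exp A_countable min_in min_le (P_stationary n n1)
  (p_version n n1) gamma_gt0 (Gamma_ge n n2) (f_estimator n) m_gt0 b s_ge0) _.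
rewrite ler_expR; apply: le_trans exponent_le _.
rewrite lerN2 le_eqVlt; apply/orP; left; apply/eqP; rewrite /c.
have := K_gt0; set K := (_ + _)%:R => K_gt0'; clearbody K.
by field; rewrite !gt_eqF.
Qed.
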